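(* Let $s\in\mathbb{N}$. Let $a_j,b_j,c_j,e_j>0$ and $d_j\ge1$ for $j=1,\dots,s$, and set $$\nu(\boldsymbol{x})=\exp\left(\sum_{j=1}^s e_j\exp\left(c_j|x_j|^{d_j}\right)\right),\qquad \omega(\boldsymbol{\xi})=\exp\left(\sum_{j=1}^s a_j|\xi_j|^{b_j}\right),\qquad\boldsymbol{x},\boldsymbol{\xi}\in\mathbb{R}^s.$$ Put $$B(s)=\sum_{j=1}^s\frac1{b_j},\quad D(s)=\sum_{j=1}^s\frac1{d_j},\quad C_j=\frac{c_j^{1/d_j}a_j^{1/b_j}}{2},\quad C_*=\inf_{1\le j\le s}C_j,\quad C_\sharp=\inf_{1\le j\le s}\left(\frac{C_*}{2}\right)^{d_j},\quad e_*=\inf_{1\le j\le s}e_j.$$ For $N\in\mathbb{N}$ set $h_j=(a_jh)^{1/b_j}$ with $$h=N^{-1/B(s)}\left(\frac{\ln\left(e_*^{-B(s)}N\right)}{C_\sharp\,B(s)}\right)^{D(s)/B(s)},$$ and define $n_j$, $j=1,\dots,s$, by $$n_j+1=\max\left\{\left\lfloor\frac{C_*\,h^{\frac{B(s)}{D(s)\,d_j}}\,N^{\frac{1}{D(s)\,d_j}}}{C_j\,h^{1/b_j}}\right\rfloor,\,1\right\}.$$ Then, for all $N$ sufficiently large (with threshold depending only on $s$ and the parameters $a_j,b_j,c_j,d_j,e_j$), every $f\in E_s(\nu,\omega)$ satisfies $$|I(f)-Q_{\boldsymbol{h}}^{\mathscr{D}_{\boldsymbol{n}}}(f)|\le C'(s)\,\exp\left(-N^{1/B(s)}\left(\ln\left(e_*^{-B(s)}N\right)\right)^{-D(s)/B(s)}C_\sharp^{D(s)/B(s)}\,B(s)^{D(s)/B(s)}\right)\|f\|,$$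 where $$C'(s)=4\,s\prod_{j=1}^s\mathrm{e}^{-e_j}\left(a_j^{1/b_j}+2\,\frac{\Gamma(1/d_j)}{e_j\,c_j^{1/d_j}\,d_j}\right)+4\,\mathrm{e}\sum_{\emptyset\neq\mathfrak{u}\subseteq\{1,\dots,s\}}\ \prod_{j\in\mathfrak{u}}\frac{\Gamma(1/b_j)}{b_j},$$ and $$(n_1+1)\cdots(n_s+1)\le N.$$
   Context: $\Gamma$ is the gamma function and $\mathrm{e}=\exp(1)$ (not to be confused with the parameters $e_j$). Fourier transform: $\hat f(\boldsymbol{\xi})=\int_{\mathbb{R}^s}f(\boldsymbol{x})\,\mathrm{e}^{-2\pi\mathrm{i}\,\boldsymbol{\xi}\cdot\boldsymbol{x}}\,\mathrm{d}\boldsymbol{x}$. Function space: for $\nu,\omega:\mathbb{R}^s\to(0,\infty)$, $E_s(\nu,\omega)$ is the space of integrable functions $f:\mathbb{R}^s\to\mathbb{R}$ with $$\|f\|:=\|f\,\nu\|_{L^\infty(\mathbb{R}^s)}+\|\hat f\,\omega\|_{L^\infty(\mathbb{R}^s)}<\infty.$$ Since point values of $f$ are used, $f$ is understood to be continuous (i.e. identified with its continuous representative). Integral: $I(f)=\int_{\mathbb{R}^s}f(\boldsymbol{x})\,\mathrm{d}\boldsymbol{x}$. Truncated trapezoidal rule: for mesh sizes $\boldsymbol{h}=(h_1,\dots,h_s)$ with $h_j>0$ and $\boldsymbol{n}=(n_1,\dots,n_s)$ with nonnegative integers $n_j$, $$Q_{\boldsymbol{h}}^{\mathscr{D}_{\boldsymbol{n}}}(f)=h_1\cdots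 h_s\sum_{\boldsymbol{k}\in\mathscr{D}_{\boldsymbol{n}}}f(k_1h_1,\dots,k_sh_s),$$ where $\mathscr{D}_{\boldsymbol{n}}=\{\boldsymbol{k}\in\mathbb{Z}^s:\ -n_j/2\le k_j\le n_j/2\text{ for all }j=1,\dots,s\}$. *)

(* Defs.v *)
From HB Require Import structures.
From mathcomp Require Import all_boot all_order all_algebra.
From mathcomp Require Import all_classical all_reals all_analysis.
From mathcomp Require Import complex.

Set Implicit Arguments.
Unset Strict Implicit.
Unset Printing Implicit Defensive.

Import Order.TTheory GRing.Theory Num.Theory.
Import numFieldNormedType.Exports.

Local Open Scope classical_set_scope.
Local Open Scope ring_scope.

(* The product sigma-algebra on row vectors, i.e. the one generated by the
   coordinate projections; for [T = R] it is the Borel sigma-algebra of R^n. *)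
Definition measure_rV_display : measure_display -> measure_display.
Proof. exact. Qed.

Section measurable_rV.
Context {d} {T : measurableType d} (n : nat).

Definition coord_rV (i : 'I_n) (x : 'rV[T]_n) : T := x ord0 i.

Let rV_set0 : g_sigma_preimage coord_rV set0.
Proof. exact: sigma_algebra0. Qed.

Let rV_setC A : g_sigma_preimage coord_rV A -> g_sigma_preimage coord_rV (~` A).
Proof. exact: sigma_algebraC. Qed.

Let rV_bigcup (F : (set 'rV[T]_n)^nat) :
  (forall i, g_sigma_preimage coord_rV (F i)) ->
  g_sigma_preimage coord_rV (\bigcup_i F i).
Proof. exact: sigma_algebra_bigcup. Qed.

HB.instance Definition _ := @isMeasurable.Build (measure_rV_display d)
  'rV[T]_n (g_sigma_preimage coord_rV) rV_set0 rV_setC rV_bigcup.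

Lemma measurable_coord_rV (i : 'I_n) : measurable_fun [set: 'rV[T]_n] (coord_rV i).
Proof.
move=> _ Y mY; rewrite setTI; apply: sub_sigma_algebra => /=.
rewrite -bigcup_seq/=; exists i => /=; first by rewrite mem_index_enum.
by exists Y => //; rewrite setTI.
Qed.

Lemma measurable_fun_rV d1 (T1 : measurableType d1) (f : T1 -> 'rV[T]_n) :
  (forall i, measurable_fun [set: T1] (coord_rV i \o f)) ->
  measurable_fun [set: T1] f.
Proof.
move=> mf _ A mA; rewrite setTI.
have : g_sigma_preimage (fun i => coord_rV i \o f) `<=` measurable.
  apply: smallest_sub; first exact: sigma_algebra_measurable.
  rewrite -bigcup_seq; apply: bigcup_sub => i _ _ [B mB <-].
  exact: mf.
apply; rewrite g_sigma_preimage_comp.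
by exists A => //; rewrite setTI.
Qed.

End measurable_rV.

Section lebesgue_rV.
Context {R : realType}.

Local Notation RM := (measurableTypeR R).

Definition cons_rV n (p : RM * 'rV[R]_n) : 'rV[R]_n.+1 :=
  row_mx (const_mx p.1 : 'rV[R]_1) p.2.

Definition uncons_rV n (x : 'rV[R]_n.+1) : RM * 'rV[R]_n :=
  (x ord0 ord0, \row_j x ord0 (lift ord0 j)).

Lemma cons_rV0 n (p : RM * 'rV[R]_n) : cons_rV p ord0 ord0 = p.1.
Proof.
have -> : (ord0 : 'I_n.+1) = lshift n (ord0 : 'I_1) by apply/val_inj.
by rewrite /cons_rV (@row_mxEl _ 1 1 n) mxE.
Qed.

Lemma cons_rVS n (p : RM * 'rV[R]_n) i :
  cons_rV p ord0 (lift ord0 i) = p.2 ord0 i.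
Proof.
have -> : lift ord0 i = rshift 1 i by apply/val_inj.
by rewrite /cons_rV (@row_mxEr _ 1 1 n).
Qed.

Lemma cons_rVK n : cancel (@cons_rV n) (@uncons_rV n).
Proof.
move=> [a x]; rewrite /uncons_rV cons_rV0; congr pair.
by apply/rowP => j; rewrite mxE cons_rVS.
Qed.

Lemma measurable_cons_rV n : measurable_fun [set: RM * 'rV[R]_n] (@cons_rV n).
Proof.
apply: measurable_fun_rV => i.
have [j ->|->] := unliftP ord0 i.
  rewrite (_ : _ \o _ = coord_rV j \o snd); last first.
    by apply/funext => p; rewrite /= /coord_rV cons_rVS.
  exact: measurableT_comp (measurable_coord_rV j) _.
rewrite (_ : _ \o _ = fst); first exact: measurable_fst.
by apply/funext => p; rewrite /= /coord_rV cons_rV0.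
Qed.

Lemma measurable_uncons_rV n : measurable_fun [set: 'rV[R]_n.+1] (@uncons_rV n).
Proof.
apply: measurable_fun_pair; first exact: (measurable_coord_rV ord0).
apply: measurable_fun_rV => i.
rewrite (_ : _ \o _ = coord_rV (lift ord0 i)); last first.
  by apply/funext => x; rewrite /= /coord_rV mxE.
exact: measurable_coord_rV.
Qed.

Section cons_measure.
Context (n : nat) (mu : {sigma_finite_measure set 'rV[R]_n -> \bar R}).

Definition cons_measure : set 'rV[R]_n.+1 -> \bar R :=
  pushforward (@lebesgue_measure R \x mu)%E (@cons_rV n).

HB.instance Definition _ := Measure.copy cons_measure
  (measure_function_pushforward__canonical__measure_function_Measure
    (lebesgue_measure \x mu)%E (@measurable_cons_rV n)).

Let cons_measure_sigma_finite : sigma_finite setT cons_measure.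
Proof.
have /sigma_finiteP[F [TF ndF Foo]] := sigma_finiteT (@lebesgue_measure R).
have /sigma_finiteP[G [TG ndG Goo]] := sigma_finiteT mu.
exists (fun k => @uncons_rV n @^-1` (F k `*` G k)).
  rewrite -preimage_bigcup (_ : \bigcup_i _ = setT) ?preimage_setT//.
  apply/seteqP; split => // -[x y] _.
  have : [set: RM] x by []. rewrite TF => -[i _ Fx].
  have : [set: 'rV[R]_n] y by []. rewrite TG => -[k _ Gy].
  exists (maxn i k) => //; split.
  - by move: Fx; exact/subsetPset/ndF/leq_maxl.
  - by move: Gy; exact/subsetPset/ndG/leq_maxr.
move=> k; have [? ?] := Foo k; have [? ?] := Goo k; split.
  by rewrite -[X in measurable X]setTI; apply: measurable_uncons_rV => //;
    exact: measurableX.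
rewrite /cons_measure /pushforward (_ : _ @^-1` _ = F k `*` G k).
  by rewrite product_measure1E// lte_mul_pinfty// ge0_fin_numE.
by apply/funext => p; rewrite /preimage/mkset cons_rVK.
Qed.

HB.instance Definition _ := Measure_isSigmaFinite.Build _ _ _ cons_measure
  cons_measure_sigma_finite.

End cons_measure.

(* Lebesgue measure on R^n: the n-fold product of [lebesgue_measure]. *)
Fixpoint lebesgue_rV n : {sigma_finite_measure set 'rV[R]_n -> \bar R} :=
  match n with
  | 0 => \d_(0 : 'rV[R]_0)
  | m.+1 => cons_measure (lebesgue_rV m)
  end.

End lebesgue_rV.

Lemma lebesgue_rV_box (R : realType) n (A : 'I_n -> set (measurableTypeR R)) :
  (forall i, measurable (A i)) ->
  lebesgue_rV n [set x : 'rV[R]_n | forall i, A i (x ord0 i)] =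
  (\prod_(i < n) lebesgue_measure (A i))%E.
Proof.
elim: n A => [|n IHn] A mA.
  by rewrite big_ord0 /= diracE mem_set// => -[].
rewrite big_ord_recl -IHn; last by move=> i; exact: mA.
set B := [set x : 'rV[R]_n | _].
have mB : measurable B.
  have -> : B = \bigcap_(i in [set: 'I_n]) (coord_rV i @^-1` A (lift ord0 i)).
    by apply/seteqP; split => x /= xB i => [_|]; exact: xB.
  apply: fin_bigcap_measurable => // i _; rewrite -[X in measurable X]setTI.
  exact: (@measurable_coord_rV _ R n i measurableT (A (lift ord0 i)) (mA _)).
rewrite -product_measure1E//= /cons_measure /pushforward; congr (_ \x _)%E.
apply/funext => -[t x]; apply/propext; split => /= [xA|[At xB] i].
  split; first by have := xA ord0; rewrite cons_rV0.
  by move=> i; have := xA (lift ord0 i); rewrite cons_rVS.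
by have [j ->|->] := unliftP ord0 i; rewrite ?cons_rVS ?cons_rV0.
Qed.

Section function_space.
Context {R : realType}.
Implicit Types (s : nat).

Local Open Scope complex_scope.

Definition Cintegral d (T : measurableType d) (mu : {measure set T -> \bar R})
    (g : T -> R[i]) : R[i] :=
  (\int[mu]_x complex.Re (g x)) +i* (\int[mu]_x complex.Im (g x)).

(* e^(it) *)
Definition expi (t : R) : R[i] := cos t +i* sin t.

Definition fourier s (f : 'rV[R]_s -> R) (xi : 'rV[R]_s) : R[i] :=
  Cintegral (lebesgue_rV s) (fun x : 'rV[R]_s =>
    (f x)%:C * expi (- (2 * pi * \sum_(j < s) xi ord0 j * x ord0 j))).

Definition E_norm s (nu omega f : 'rV[R]_s -> R) : \bar R :=
  ('N[lebesgue_rV s]_+oo[EFin \o (fun x => f x * nu x)%R] +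
   'N[lebesgue_rV s]_+oo[EFin \o (fun xi =>
      ComplexField.Normc.normc (fourier f xi * (omega xi)%:C%C))%R])%E.

(* Membership in E_s(nu, omega); since point values are taken, elements are
   represented by their continuous versions. *)
Definition in_E s (nu omega f : 'rV[R]_s -> R) : Prop :=
  [/\ continuous f,
      (lebesgue_rV s).-integrable [set: 'rV[R]_s] (EFin \o f) &
      (E_norm nu omega f < +oo)%E].

End function_space.

Definition trapezoidal_index s (n : 'I_s -> nat) : set 'rV[int]_s :=
  [set k | forall j, - ((n j)%:R / 2) <= (k ord0 j)%:Q <= (n j)%:R / 2].

(* Ensures that the sum below, over [\in], is not the default one. *)
Lemma finite_trapezoidal_index s (n : 'I_s -> nat) :
  finite_set (trapezoidal_index n).
Proof.
pose M := \max_(j < s) n j.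
apply: (@sub_finite_set _ _
  ((fun g : {ffun 'I_s -> 'I_M.*2.+1} => \row_j ((g j)%:Z - M%:Z)) @` setT)).
  move=> k kn; exists [ffun j => inord (absz (k ord0 j + M%:Z))] => //.
  apply/rowP => j; rewrite mxE ffunE.
  have nM : (n j <= M)%N := leq_bigmax j.
  have /andP[k1 k2] := kn j.
  have n2 : (n j)%:R / 2 <= M%:R :> rat.
    by rewrite ler_pdivrMr// -natrM ler_nat muln2 -addnn (leq_trans nM)// leq_addr.
  have k1M : - M%:Z <= k ord0 j.
    by rewrite -(ler_int rat) rmorphN/=; apply: le_trans k1; rewrite lerN2.
  have k2M : k ord0 j <= M%:Z.
    by rewrite -(ler_int rat); exact: le_trans n2.
  have kM0 : 0 <= k ord0 j + M%:Z by rewrite -lerBlDr sub0r.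
  rewrite inordK ?gez0_abs ?addrK//.
  by rewrite ltnS -lez_nat gez0_abs// -addnn PoszD lerD2r.
exact: finite_image.
Qed.

Section trapezoidal_rule.
Context {R : realType}.

Definition trapezoidal s (h : 'I_s -> R) (n : 'I_s -> nat)
    (f : 'rV[R]_s -> R) : R :=
  (\prod_(j < s) h j) *
  \sum_(k \in trapezoidal_index n) f (\row_j ((k ord0 j)%:~R * h j)).

Definition Gamma (x : R) : R :=
  \int[lebesgue_measure]_(t in `]0, +oo[) (t `^ (x - 1) * expR (- t)).

End trapezoidal_rule.

(* Main.v *)
(* The trapezoidal error is compared with integrals against a trigonometric
   approximate identity, which avoids Poisson summation.  Put
   K_m(t) = 4^m / C(2m,m) * cos(pi t)^(2m); it is nonnegative, 1-periodic, of
   mean 1, concentrates at the integers, and its Fourier coefficients lie in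
   [0,1] with constant coefficient 1.  Integrating f against
   prod_j K_m(x_j/h_j) gives a finite combination of values of the Fourier
   transform at the points k/h: the term k = 0 is I(f), and the others
   are at most the aliasing sum of 1/omega(k/h).  As m tends to infinity, the
   cell around each node contributes h_1...h_s f(kh), while outside the box of
   nodes used by the rule 1/nu is small uniformly in m.  With w = 1/h, the
   aliasing sum is (2s + o(1)) exp(-w), whereas the truncation error is
   O(exp(-N^(1/B)/2)) with N^(1/B)/w tending to infinity, hence negligible;
   since Gamma(1/b)/b >= (3/4)/e, already the singletons u in C'(s) absorb
   3 s exp(-w). *)

Require Import Defs.
From mathcomp Require Import all_boot all_order all_algebra.
From mathcomp Require Import all_classical all_reals all_analysis.
From mathcomp Require Import complex measurable_realfun ess_sup_inf zify ring lra.

Set Implicit Arguments.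
Unset Strict Implicit.
Unset Printing Implicit Defensive.

Import Order.TTheory GRing.Theory Num.Theory.
Import numFieldNormedType.Exports.

Local Open Scope classical_set_scope.
Local Open Scope ring_scope.

(** * The Gamma integral *)

(** Since the kernel is a trigonometric polynomial, every exchange of sum and integral is finite. No
    limit of integrals is formed either: the aliasing and truncation bounds hold for every m, and
    for each eta > 0 one m is taken, large enough for the finitely many nodes. The first obstacle is
    that the maximum of K_m grows with m, so the tail cannot be bounded through the size of the
    kernel. But each period has mass h whatever m is, and outside the box f is dominated by a
    product of exponentials; a geometric series over the periods then gives a bound free of m. Half
    of the exponent of nu pays for this domination, the other half for smallness. The second
    obstacle is that both norms are essential suprema, while values at single points are used;
    continuity of f and of its transform closes the gap. The budget: a one-sided, one-dimensional
    aliasing sum costs 9/8 exp(-w), the product over coordinates turns 2 * 9/8 * s into at most 5/2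
    * s, and the truncation gets s/2. The total 3 s equals 4 e * s * (3/4)/e. *)

Lemma integral_is_derive (R : realType) (F f : R -> R) (u v : R) : u < v ->
  (forall x, u <= x <= v -> is_derive x 1 F (f x)) ->
  {within `[u, v], continuous f} ->
  (\int[lebesgue_measure]_(x in `[u, v]) (f x)%:E = (F v - F u)%:E)%E.
Proof.
move=> uv dF cf; rewrite (continuous_FTC2 uv cf (F := F)) ?EFinB//.
  have cF : {within `[u, v], continuous F}.
    apply: derivable_within_continuous => x; rewrite in_itv/= => /dF dFx.
    exact: ex_derive.
  have /continuous_within_itvP := cF => /(_ uv)[_ Fu Fv]; split => // x.
  rewrite in_itv/= => /andP[ux xv].
  by have := dF x; rewrite !ltW// => /(_ isT) dFx; exact: ex_derive.
move=> x; rewrite in_itv/= => /andP[ux xv].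
by rewrite derive1E; have := dF x; rewrite !ltW// => /(_ isT) dFx; exact: derive_val.
Qed.

Lemma continuous_powR (R : realType) (p x : R) : 0 < x ->
  {for x, continuous (fun t : R => t `^ p)}.
Proof.
move=> x0; apply: differentiable_continuous; apply/derivable1_diffP.
by apply: derivable_powR; rewrite in_itv/= x0.
Qed.

Section gamma.
Context {R : realType}.
Variable p : R.
Hypothesis p0 : 0 < p.

(** The derivative [f] of [F] behaves like t^(p-1) at 0 and decays like t^(-p-1) at infinity, so it
    handles both ends of the Gamma integral at once, and [F] stays between -1 and 0. *)
Let F (t : R) : R := - (1 + t `^ p)^-1.
Let f (t : R) : R := (1 + t `^ p) ^- 2 * (p * t `^ (p - 1)).

Let F_derive (t : R) : 0 < t -> is_derive t 1 F (f t).
Proof.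
move=> t0.
have t1 : 1 + t `^ p != 0 by rewrite gt_eqF// ltr_wpDr// powR_ge0.
have d1 : is_derive t 1 (fun x : R => 1 + x `^ p) (0 + p * t `^ (p - 1)).
  exact: (is_deriveD (is_derive_cst (1 : R) t 1) (is_derive1_powR p t0)).
have d2 := is_deriveN (@is_deriveV _ (fun x : R => 1 + x `^ p) _ _ _ t1 d1).
by apply: is_derive_eq d2 _; rewrite /f add0r scaleNr opprK.
Qed.

(** The square of 1 + t^p is at most 2 (1 + t^(2p)), and t^(2p) <= (1 + t)^m <= m! exp(1 + t) by one
    term of the exponential series. *)
Lemma powR_expRN_le (m : nat) : p * 2 <= m%:R -> forall t : R, 0 < t ->
  expR (- t) <= (1 + m`!%:R * expR 1) * 2 * (1 + t `^ p) ^- 2.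
Proof.
move=> pm t t0; rewrite ler_pdivlMr ?exprn_gt0// ?ltr_wpDr// ?powR_ge0//.
have h1 : (1 + t `^ p) ^+ 2 <= 2 * (1 + t `^ (p * 2)).
  by rewrite powRrM powR_mulrn ?powR_ge0//; have := sqr_ge0 (1 - t `^ p); nra.
have h2 : t `^ (p * 2) <= (1 + t) ^+ m.
  apply: (@le_trans _ _ ((1 + t) `^ (p * 2))).
    by rewrite ge0_ler_powR ?nnegrE ?addr_ge0 ?ltW ?mulr_gt0// ltrDr.
  have t1 : 1 <= 1 + t by rewrite lerDl ltW.
  by rewrite -powR_mulrn ?(le_trans ler01 t1)//; exact: (ler_powR t1).
have h3 : (1 + t) ^+ m <= m`!%:R * expR (1 + t).
  case: (m) => [|k].
    by rewrite fact0 expr0 mul1r (le_trans _ (expR_ge1Dx _))//; lra.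
  have /(le_trans _) h := expR_ge1Dxn k (addr_ge0 ler01 (ltW t0)).
  rewrite mulrC -ler_pdivrMr ?ltr0n ?fact_gt0//.
  by apply: h; rewrite lerDr.
have h4 : 1 <= expR t by rewrite -expR0 ler_expR ltW.
rewrite expRD in h3.
have e0 := expR_gt0 (- t).
have : (1 + t `^ p) ^+ 2 <= 2 * (1 + m`!%:R * expR 1) * expR t.
  have : 0 <= m`!%:R * expR 1 * expR t :> R by rewrite !mulr_ge0 ?expR_ge0.
  nra.
rewrite -(ler_pM2l e0) => /le_trans; apply.
by rewrite mulrCA -expRD addNr expR0 mulr1 mulrC.
Qed.

(* The integrand is at most a multiple of [f], the derivative of the bounded [F]. *)
Lemma Gamma_integrable :
  lebesgue_measure.-integrable `]0, +oo[
    (EFin \o (fun t : R => t `^ (p - 1) * expR (- t))).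
Proof.
have cg (t : R) : 0 < t -> {for t, continuous (fun t : R => t `^ (p - 1) * expR (- t))}.
  move=> t0; apply: cvgM; first exact: continuous_powR.
  by apply: (@continuous_comp _ _ _ (fun t : R => - t) expR);
    [exact: opp_continuous|exact: continuous_expR].
have cf (t : R) : 0 < t -> {for t, continuous f}.
  move=> t0; apply: cvgM; last first.
    by apply: cvgM; [exact: cvg_cst|exact: continuous_powR].
  have t1 : 1 + t `^ p != 0 by rewrite gt_eqF// ltr_wpDr// powR_ge0.
  apply: cvgV; first by rewrite expf_neq0.
  apply: (@continuous_comp _ _ _ (fun x : R => 1 + x `^ p) (fun y => y ^+ 2)).
    by apply: cvgD; [exact: cvg_cst|exact: continuous_powR].
  exact: exprn_continuous.
have mg : measurable_fun `](0 : R), +oo[ (fun t : R => t `^ (p - 1) * expR (- t)).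
  apply: open_continuous_measurable_fun => //.
  by move=> t; rewrite inE/= in_itv/= andbT; exact: cg.
apply/integrableP; split; first exact/measurable_EFinP.
(* Compact intervals stay away from the singularity at 0 that occurs for p < 1; the shift by 2 keeps
   each of them nondegenerate. *)
pose I (n : nat) : set R := `[n.+2%:R^-1, n.+2%:R]%classic.
have I_gt0 n x : I n x -> 0 < x.
  by rewrite /I/= in_itv/= => /andP[+ _]; apply: lt_le_trans; rewrite invr_gt0.
have UI : \bigcup_n I n = (`]0, +oo[%classic : set R).
  apply/seteqP; split => [x [n _ /I_gt0]|x]; first by rewrite /= in_itv/= andbT.
  rewrite /= in_itv/= andbT => x0.
  exists (maxn (Num.bound x) (Num.bound x^-1)) => //; rewrite /I/= in_itv/=.
  apply/andP; split.
    rewrite -[leRHS]invrK lef_pV2 ?posrE ?invr_gt0//.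
    have := archi_boundP (ltW (_ : 0 < x^-1)); rewrite invr_gt0 => /(_ x0).
    move=> /ltW/le_trans; apply; rewrite ler_nat.
    by rewrite (leq_trans (leq_maxr (Num.bound x) _))// ltnW// ltnW.
  have := archi_boundP (ltW x0).
  move=> /ltW/le_trans; apply; rewrite ler_nat.
  by rewrite (leq_trans (leq_maxl _ (Num.bound x^-1)))// ltnW// ltnW.
rewrite -UI.
have ndI : nondecreasing_seq I.
  move=> n m nm; apply/subsetPset => x; rewrite /I/= !in_itv/= => /andP[h1 h2].
  apply/andP; split.
    by apply: le_trans h1; rewrite lef_pV2 ?posrE// ler_nat !ltnS.
  by apply: le_trans h2 _; rewrite ler_nat !ltnS.
have mI n : measurable (I n) by exact: measurable_itv.
have mfI n : measurable_fun (I n) f.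
  apply: (@measurable_funS _ _ _ _ (`](0 : R), +oo[%classic)) => //.
    by move=> x /I_gt0; rewrite /= in_itv/= andbT.
  apply: open_continuous_measurable_fun => //.
  by move=> t; rewrite inE/= in_itv/= andbT; exact: cf.
have mgI n : measurable_fun (I n)
    (fun t : R => `|(t `^ (p - 1) * expR (- t))%:E|)%E.
  apply: measurableT_comp => //; apply/measurable_EFinP.
  apply: measurable_funS mg => // x /I_gt0; by rewrite /= in_itv/= andbT.
have H := ge0_nondecreasing_set_cvg_integral (mu := lebesgue_measure)
  ndI mI mgI (fun _ _ _ => abse_ge0 _).
have p2 : 0 <= p * 2 by rewrite mulr_ge0 ?ltW.
pose m := Num.bound (p * 2).
have pm : p * 2 <= m%:R by apply/ltW/archi_boundP.
pose C : R := (1 + m`!%:R * expR 1) * 2 / p.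
have C0 : 0 <= C by rewrite !mulr_ge0 ?invr_ge0 ?addr_ge0 ?mulr_ge0 ?expR_ge0// ltW.
have f0 (x : R) : 0 < x -> 0 <= f x.
  by move=> x0; rewrite /f mulr_ge0 ?mulr_ge0 ?powR_ge0 ?invr_ge0 ?sqr_ge0// ltW.
have fC (x : R) : 0 < x -> x `^ (p - 1) * expR (- x) <= C * f x.
  move=> x0; have := ler_wpM2l (powR_ge0 x (p - 1)) (powR_expRN_le pm x0).
  move=> h; apply: (le_trans h).
  rewrite /C /f le_eqVlt; apply/orP; left; apply/eqP; field.
  by rewrite (gt_eqF p0) andbT gt_eqF// ltr_wpDr// powR_ge0.
have Ib n : (\int[lebesgue_measure]_(t in I n)
    `|(t `^ (p - 1) * expR (- t))%:E| <= C%:E)%E.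
  apply: (@le_trans _ _ (\int[lebesgue_measure]_(t in I n) (C * f t)%:E)%E).
    apply: ge0_le_integral => //.
    - exact: mI.
    - exact: mgI.
    - apply/measurable_EFinP/measurable_funM => //.
      exact: mfI.
    - move=> x /I_gt0 x0; rewrite lee_fin ger0_norm ?mulr_ge0 ?powR_ge0 ?expR_ge0//.
      exact: fC.
  have ab : n.+2%:R^-1 < n.+2%:R :> R.
    rewrite (@lt_trans _ _ 1)//; last by rewrite ltr1n.
    by rewrite invf_lt1 ?ltr1n.
  under eq_integral do rewrite EFinM.
  rewrite ge0_integralZl//; last 3 first.
  - exact: mI.
  - by apply/measurable_EFinP; exact: mfI.
  - by move=> x /I_gt0 x0; rewrite lee_fin f0.
  have dF (x : R) : n.+2%:R^-1 <= x <= n.+2%:R -> is_derive x 1 F (f x).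
    by move=> xI; apply: F_derive; apply: (I_gt0 n); rewrite /I/= in_itv/=.
  have cF : {within `[n.+2%:R^-1, n.+2%:R], continuous f}.
    by apply: continuous_in_subspaceT => x; rewrite inE => /(I_gt0 n); exact: cf.
  rewrite (integral_is_derive ab dF cF).
  rewrite -EFinM lee_fin -[leRHS]mulr1 ler_wpM2l// /F opprK.
  set a := n.+2%:R; have h1 : 0 <= (1 + a `^ p)^-1 by rewrite invr_ge0 addr_ge0 ?powR_ge0.
  have h2 : (1 + a^-1 `^ p)^-1 <= 1 by rewrite invf_le1 ?lerDl ?ltr_wpDr// powR_ge0.
  lra.
apply: (@le_lt_trans _ _ C%:E); last exact: ltry.
by rewrite -(cvg_lim _ H)//; apply: lime_le; [apply/cvg_ex; eexists; exact: H|exact: nearW].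
Qed.

Lemma Gamma_ge0 : 0 <= Gamma p.
Proof.
by apply: Rintegral_ge0 => t _; rewrite mulr_ge0 ?powR_ge0 ?expR_ge0.
Qed.

Lemma Gamma_ge : 3 / 4 * expR (- 1) / p <= Gamma p.
Proof.
(* The integral of [t `^ (p - 1)] over [eps, 1] is [3 / 4 / p]. *)
pose eps : R := (4^-1) `^ p^-1.
have eps0 : 0 < eps by apply: powR_gt0; lra.
have epsp : eps `^ p = 4^-1 by rewrite /eps -powRrM mulVf ?gt_eqF// powRr1.
have eps1 : eps < 1.
  rewrite ltNge; apply/negP => h.
  have := ge0_ler_powR (ltW p0) _ _ h; rewrite epsp powR1 !nnegrE ler01 ltW//.
  by move=> /(_ isT isT); lra.
have sub : (`[eps, 1]%classic : set R) `<=` `]0, +oo[%classic.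
  by move=> x; rewrite /= !in_itv/= andbT => /andP[+ _]; apply: lt_le_trans.
have c (x : R) : eps <= x <= 1 -> {for x, continuous (fun x : R => x `^ (p - 1))}.
  by move=> /andP[ex _]; apply: continuous_powR; exact: lt_le_trans ex.
have c' : {within `[eps, 1], continuous (fun x : R => x `^ (p - 1))}.
  apply: continuous_in_subspaceT => x; rewrite inE/= in_itv/=; exact: c.
have [mG _] := integrableP _ _ _ Gamma_integrable.
rewrite -lee_fin /Gamma /Rintegral fineK; last exact: integrable_fin_num Gamma_integrable.
apply: (@le_trans _ _ (\int[lebesgue_measure]_(t in `[eps, 1%R]) (t `^ (p - 1) * expR (- t))%:E)%E); last first.
  apply: ge0_subset_integral => //.
  by move=> x _; rewrite lee_fin mulr_ge0 ?powR_ge0 ?expR_ge0.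
apply: (@le_trans _ _ (\int[lebesgue_measure]_(t in `[eps, 1%R]) (expR (- 1) * t `^ (p - 1))%:E)%E); last first.
  apply: ge0_le_integral => //.
  - by move=> x _; rewrite lee_fin mulr_ge0 ?powR_ge0 ?expR_ge0.
  - apply/measurable_EFinP/measurable_funM => //.
    by apply: subspace_continuous_measurable_fun.
  - by move/measurable_EFinP : mG => mG; apply/measurable_EFinP; exact: measurable_funS mG.
  - move=> x; rewrite /= in_itv/= => /andP[_ x1].
    by rewrite lee_fin mulrC ler_wpM2l ?powR_ge0// ler_expR lerN2.
have dF (x : R) : eps <= x <= 1 ->
    is_derive x 1 (fun x : R => expR (- 1) / p * x `^ p) (expR (- 1) * x `^ (p - 1)).
  move=> /andP[ex _]; have x0 : 0 < x by exact: lt_le_trans ex.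
  have h : is_derive x 1 (fun x : R => expR (- 1) / p * x `^ p)
      ((expR (- 1) / p) *: (p * x `^ (p - 1))).
    exact: (@is_deriveZ _ _ _ (fun x : R => x `^ p) _ _ _ _ (is_derive1_powR p x0)).
  by apply: is_derive_eq h _; rewrite /GRing.scale/= mulrA divfK ?gt_eqF.
have cF : {within `[eps, 1], continuous (fun x : R => expR (- 1) * x `^ (p - 1))}.
  apply: continuous_in_subspaceT => x; rewrite inE/= in_itv/= => xe.
  by apply: cvgM; [exact: cvg_cst|exact: c].
rewrite (integral_is_derive eps1 dF cF) lee_fin epsp powR1 le_eqVlt.
by apply/orP; left; apply/eqP; field; rewrite gt_eqF.
Qed.

End gamma.

(** * Product integrals on row vectors *)

(** Induction along the recursive construction of [lebesgue_rV]: the pushforward by [cons_rV]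
    becomes an integral for a product measure, and Tonelli splits off the first coordinate. *)
Lemma ge0_integral_prod_rV (R : realType) n (G : 'I_n -> R -> R) :
  (forall i, measurable_fun [set: R] (G i)) ->
  (forall i t, 0 <= G i t) ->
  (\int[lebesgue_rV n]_x (\prod_(i < n) G i (x ord0 i))%:E =
   \prod_(i < n) \int[lebesgue_measure]_t (G i t)%:E)%E.
Proof.
elim: n G => [|n IHn] G mG G0.
  rewrite big_ord0 /= integral_dirac//.
    by rewrite diracE in_setT mul1e big_ord0.
  by under eq_fun do rewrite big_ord0; exact: measurable_cst.
have mP k (H : 'I_k -> R -> R) : (forall i, measurable_fun [set: R] (H i)) ->
    measurable_fun [set: 'rV[R]_k] (fun x => \prod_(i < k) H i (x ord0 i)).
  move=> mH; apply: measurable_prod => i _.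
  exact: (measurableT_comp (mH i) (measurable_coord_rV i)).
rewrite big_ord_recl /= ge0_integral_pushforward//; last 3 first.
- exact: measurable_cons_rV.
- by apply/measurable_EFinP; exact: mP.
- by move=> x _; rewrite lee_fin prodr_ge0.
rewrite preimage_setT fubini_tonelli1//; last 2 first.
- apply: measurableT_comp; last exact: measurable_cons_rV.
  by apply/measurable_EFinP; exact: mP.
- by move=> x; rewrite lee_fin prodr_ge0.
rewrite -IHn// /fubini_F /=.
rewrite -ge0_integralZr//; last 3 first.
- by apply/measurable_EFinP; exact: mG.
- by move=> t _; rewrite lee_fin.
- by apply: integral_ge0 => x _; rewrite lee_fin prodr_ge0.
apply: eq_integral => t _.
rewrite -ge0_integralZl//; last 3 first.
- by apply/measurable_EFinP; exact: (mP n (fun i => G (lift ord0 i))).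
- by move=> x _; rewrite lee_fin prodr_ge0.
- by rewrite lee_fin.
apply: eq_integral => x _; rewrite -EFinM big_ord_recl cons_rV0; congr (_ * _)%:E.
by apply: eq_bigr => i _; rewrite cons_rVS.
Qed.

(** * The trigonometric kernel *)

Section expi_theory.
Context {R : realType}.
Implicit Types (x y : R).

Lemma expi0 : expi (0 : R) = 1.
Proof. by rewrite /expi cos0 sin0. Qed.

Lemma expiD x y : expi (x + y) = expi x * expi y.
Proof.
by rewrite /expi cosD sinD; apply/eqP; rewrite eq_complex/= [X in _ && (_ == X)]addrC !eqxx.
Qed.

Lemma expi_sum (I : Type) (r : seq I) (P : pred I) (F : I -> R) :
  expi (\sum_(i <- r | P i) F i) = \prod_(i <- r | P i) expi (F i).
Proof. exact: (big_morph _ expiD expi0). Qed.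

Lemma expiMn x n : expi x ^+ n = expi (x *+ n).
Proof.
by elim: n => [|n IH]; rewrite ?mulr0n ?expi0// exprS IH -expiD -mulrS.
Qed.

Lemma Re_sum (I : Type) (r : seq I) (P : pred I) (F : I -> R[i]) :
  complex.Re (\sum_(i <- r | P i) F i) = \sum_(i <- r | P i) complex.Re (F i).
Proof. by apply: (big_morph (@complex.Re R)) => // -[a b] [c d]. Qed.

Lemma Re_scale_expi x y : complex.Re (x%:C%C * expi y) = x * cos y.
Proof. by rewrite /= mul0r subr0. Qed.

Lemma cos_expi x : (cos x)%:C%C = 2^-1 * (expi x + expi (- x)).
Proof.
apply: (@mulfI _ (2 : R[i])); first by rewrite pnatr_eq0.
rewrite mulrA mulfV ?pnatr_eq0// mul1r.
apply/eqP; rewrite eq_complex/= cosN sinN subrr.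
by apply/andP; split; apply/eqP; ring.
Qed.

End expi_theory.

Section trig_kernel.
Context {R : realType}.
Implicit Types (m n i : nat) (t u h : R).

(** Fourier coefficient of [trig_kernel m] at the frequency [i - m]; the shift by [m] lets a natural
    number index all frequencies from [-m] to [m]. *)
Definition kernel_coef m i : R := 'C(m.*2, i)%:R / 'C(m.*2, m)%:R.

Definition trig_kernel m t : R :=
  2 ^+ m.*2 / 'C(m.*2, m)%:R * cos (pi * t) ^+ m.*2.

Lemma bin_central_gt0 m : 0 < 'C(m.*2, m)%:R :> R.
Proof. by rewrite ltr0n bin_gt0 -addnn leq_addr. Qed.

(** Binomial coefficients increase up to the middle index, which is an induction on the distance
    [m - k]; beyond the middle, symmetry reduces to that case. *)
Lemma bin_central_max m i : ('C(m.*2, i) <= 'C(m.*2, m))%N.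
Proof.
have inc k j : (k + j = m)%N -> ('C(m.*2, k) <= 'C(m.*2, m))%N.
  elim: j k => [k|j IH k]; first by rewrite addn0 => ->.
  rewrite addnS -addSn => kjm; apply: (leq_trans _ (IH _ kjm)).
  have : (k.+1 * 'C(m.*2, k) <= k.+1 * 'C(m.*2, k.+1))%N.
    rewrite mul_bin_left leq_mul2r; apply/orP; right.
    by rewrite -kjm -addnn addSn; apply: leq_trans (leq_addr j _) _; lia.
  by rewrite leq_pmul2l.
have [im|mi] := leqP i m; first by apply: (inc i (m - i)%N); rewrite subnKC.
have [i2|i2] := leqP i m.*2; last by rewrite bin_small.
rewrite -bin_sub//; apply: (inc _ (i - m)%N).
by move: mi i2; rewrite -addnn => *; lia.
Qed.

Lemma kernel_coef_ge0 m i : 0 <= kernel_coef m i.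
Proof. by rewrite divr_ge0. Qed.

Lemma kernel_coef_le1 m i : kernel_coef m i <= 1.
Proof. by rewrite ler_pdivrMr ?bin_central_gt0// mul1r ler_nat bin_central_max. Qed.

Lemma kernel_coef_mid m : kernel_coef m m = 1.
Proof. by rewrite /kernel_coef divff// gt_eqF// bin_central_gt0. Qed.

Lemma trig_kernel_ge0 m t : 0 <= trig_kernel m t.
Proof.
apply: mulr_ge0; first by rewrite divr_ge0// exprn_ge0.
by rewrite -[X in _ ^+ X]mul2n exprM exprn_ge0// sqr_ge0.
Qed.

Lemma trig_kernelN m t : trig_kernel m (- t) = trig_kernel m t.
Proof. by rewrite /trig_kernel mulrN cosN. Qed.

Lemma trig_kernel_expi m t :
  (trig_kernel m t)%:C%C = \sum_(i < m.*2.+1)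
    (kernel_coef m i)%:C%C * expi (2 * pi * ((i%:R - m%:R) * t)).
Proof.
have c0 : ('C(m.*2, m)%:R : R) != 0 by rewrite gt_eqF// bin_central_gt0.
rewrite /trig_kernel rmorphM rmorphXn/= cos_expi exprMn mulrA.
have -> : (2 ^+ m.*2 / 'C(m.*2, m)%:R : R)%:C%C * 2^-1 ^+ m.*2 = ('C(m.*2, m)%:R^-1 : R)%:C%C.
  rewrite rmorphM rmorphXn/= rmorph_nat mulrAC -exprMn mulfV ?pnatr_eq0//.
  by rewrite expr1n mul1r.
rewrite addrC exprDn big_distrr/=; apply: eq_bigr => i _.
rewrite !expiMn -expiD.
have -> : - (pi * t) *+ (m.*2 - i) + pi * t *+ i = 2 * pi * ((i%:R - m%:R) * t).
  have im : (i <= m.*2)%N by rewrite -ltnS.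
  rewrite -[- (pi * t) *+ _]mulr_natl -[pi * t *+ _]mulr_natl natrB//.
  by have -> : m.*2%:R = 2 * m%:R :> R; [rewrite -mul2n natrM|ring].
by rewrite /kernel_coef rmorphM/= rmorph_nat -mulr_natl; ring.
Qed.

Lemma trig_kernel_cos m t :
  trig_kernel m t =
  \sum_(i < m.*2.+1) kernel_coef m i * cos (2 * pi * ((i%:R - m%:R) * t)).
Proof.
have := congr1 (@complex.Re R) (trig_kernel_expi m t); rewrite /= Re_sum => ->.
by apply: eq_bigr => i _; rewrite Re_scale_expi.
Qed.

(** Complex exponentials make the product over coordinates additive in the phase, so distributing
    yields one frequency vector per [g]; the real part is taken only at the end. *)
Lemma trig_kernel_prod n (m : nat) (t : 'I_n -> R) :
  \prod_(j < n) trig_kernel m (t j) =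
  \sum_(g : {ffun 'I_n -> 'I_m.*2.+1}) (\prod_j kernel_coef m (g j)) *
    cos (2 * pi * \sum_j ((g j)%:R - m%:R) * t j).
Proof.
have : (\prod_(j < n) trig_kernel m (t j))%:C%C =
    \sum_(g : {ffun 'I_n -> 'I_m.*2.+1}) ((\prod_j kernel_coef m (g j))%:C%C *
    expi (2 * pi * \sum_j ((g j)%:R - m%:R) * t j)).
  rewrite rmorph_prod/=; under eq_bigr do rewrite trig_kernel_expi.
  rewrite bigA_distr_bigA/=; apply: eq_bigr => g _.
  by rewrite big_split/= -rmorph_prod -expi_sum -mulr_sumr.
move=> /(congr1 (@complex.Re R)); rewrite /= Re_sum => ->.
by apply: eq_bigr => g _; rewrite Re_scale_expi.
Qed.

Lemma continuous_trig_kernel m h : continuous (fun t => trig_kernel m (t / h)).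
Proof.
move=> t; apply: cvgM; first exact: cvg_cst.
apply: (@continuous_comp _ _ _ (fun t => cos (pi * (t / h))) (fun y => y ^+ m.*2)).
  apply: (@continuous_comp _ _ _ (fun t => pi * (t / h)) cos).
    apply: cvgM; first exact: cvg_cst.
    by apply: cvgM; [exact: cvg_id|exact: cvg_cst].
  exact: continuous_cos.
exact: exprn_continuous.
Qed.

Lemma measurable_trig_kernel m h :
  measurable_fun [set: R] (fun t => trig_kernel m (t / h)).
Proof. by apply: continuous_measurable_fun; exact: continuous_trig_kernel. Qed.

Lemma sin_2pi_natDl n t : sin (2 * pi * n%:R + t) = sin t.
Proof.
have -> : 2 * pi * n%:R = pi *+ 2 *+ n :> R by rewrite mulr_natl mulr_natr.
rewrite addrC; exact: (periodicn (@sinD2pi R)).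
Qed.

(** Primitive of one cosine term of the kernel. The zero frequency [i = m] is separate because the
    sine formula would divide by 0 there. *)
Let prim m (i : nat) h t : R := if i == m then t else
  h / (2 * pi * (i%:R - m%:R)) * sin (2 * pi * ((i%:R - m%:R) * (t / h))).

Let prim_derive m i h t : h != 0 ->
  is_derive t 1 (prim m i h) (cos (2 * pi * ((i%:R - m%:R) * (t / h)))).
Proof.
move=> h0; rewrite /prim; case: eqP => [->|/eqP im].
  by rewrite subrr mul0r mulr0 cos0; exact: is_derive_id.
set c : R := 2 * pi * (i%:R - m%:R) / h.
have cE (x : R) : 2 * pi * ((i%:R - m%:R) * (x / h)) = c * x by rewrite /c; ring.
have -> : (fun t0 : R => h / (2 * pi * (i%:R - m%:R)) *
    sin (2 * pi * ((i%:R - m%:R) * (t0 / h)))) =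
   (h / (2 * pi * (i%:R - m%:R))) \*: (sin \o ( *%R c)).
  by apply/funext => x; rewrite cE.
rewrite cE.
have d1 : is_derive t 1 ( *%R c) c.
  have := @is_deriveZ _ _ _ id c t 1 1 (is_derive_id t 1).
  by move=> d; apply: is_derive_eq d _; rewrite /GRing.scale/= mulr1.
have d2 := is_derive1_comp (is_derive_sin (c * t)) d1.
have d3 := @is_deriveZ _ _ _ _ (h / (2 * pi * (i%:R - m%:R))) _ _ _ d2.
apply: is_derive_eq d3 _; rewrite /GRing.scale/= /c.
have imR : (i%:R - m%:R : R) != 0 by rewrite subr_eq0 eqr_nat.
have pi0 : pi != 0 :> R by rewrite gt_eqF// pi_gt0.
move: imR pi0 {cE d1 d2 c}; move: (i%:R - m%:R) (pi : R) => w p w0 p0.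
field.
by rewrite h0 w0 p0.
Qed.

Let prim_period m i h t : h != 0 ->
  prim m i h (t + h) - prim m i h t = (i == m)%:R * h.
Proof.
move=> h0; rewrite /prim; case: eqP => [_|/eqP im].
  by rewrite addrAC subrr add0r mul1r.
rewrite mul0r -mulrBr (_ : sin _ - sin _ = 0) ?mulr0//.
apply/eqP; rewrite subr_eq0; apply/eqP.
rewrite -(sin_2pi_natDl m) -[RHS](sin_2pi_natDl i); congr sin.
by field.
Qed.

(** Over a full period only the zero frequency survives, and its coefficient is 1. The start [u] is
    arbitrary, so the lemma serves both the periods from 0 on and the cells centred at nodes. *)
Lemma integral_trig_kernel m h u : 0 < h ->
  (\int[lebesgue_measure]_(t in `[u, (u + h)%R[) (trig_kernel m (t / h))%:E = h%:E)%E.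
Proof.
move=> h0; have h1 : h != 0 by rewrite gt_eqF.
rewrite integral_itv_bndo_bndc; last first.
  apply/measurable_EFinP; apply: measurable_funTS.
  exact: measurable_trig_kernel.
have uh : u < u + h by rewrite ltrDl.
have dF (x : R) : u <= x <= u + h ->
    is_derive x 1 (\sum_(i < m.*2.+1) (kernel_coef m i) \*: prim m i h)
      (trig_kernel m (x / h)).
  move=> _; rewrite trig_kernel_cos.
  by apply: is_derive_sum => i; apply: is_deriveZ; exact: prim_derive.
rewrite (integral_is_derive uh dF); last first.
  by apply: continuous_subspaceT; exact: continuous_trig_kernel.
congr EFin; rewrite !fct_sumE -sumrB.
rewrite (eq_bigr (fun i : 'I__ => kernel_coef m i * ((nat_of_ord i == m)%:R * h))); last first.
  by move=> i _; rewrite -(prim_period m i u h1) mulrBr.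
have mm : (m < m.*2.+1)%N by rewrite ltnS -addnn leq_addr.
rewrite (bigD1 (Ordinal mm))//= eqxx kernel_coef_mid !mul1r big1 ?addr0// => i.
by rewrite -val_eqE/= => /negPf ->; rewrite mul0r mulr0.
Qed.

(** 4^m is a sum of 2m + 1 binomial coefficients, none above the central one. *)
Lemma bin_central_ge m : 2 ^+ m.*2 / 'C(m.*2, m)%:R <= m.*2.+1%:R :> R.
Proof.
rewrite ler_pdivrMr ?bin_central_gt0// -natrX -natrM ler_nat.
rewrite (_ : 2 = 1 + 1)%N// expnDn mulnC -[leqRHS](muln1 _).
apply: leq_trans (_ : \sum_(i < m.*2.+1) 'C(m.*2, m) <= _)%N.
  by apply: leq_sum => i _; rewrite !exp1n !muln1 bin_central_max.
by rewrite sum_nat_const card_ord muln1 mulnC.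
Qed.

(** The prefactor grows at most linearly in m, while cos^2(pi t) has period 1 and decreases with the
    distance to the nearest integer; a fixed distance [d > 0] therefore gives geometric decay. *)
Lemma trig_kernel_decay m (d : R) (k : int) t :
  0 <= d -> d <= `|t - k%:~R| <= 2^-1 ->
  trig_kernel m t <= m.*2.+1%:R * (cos (pi * d) ^+ 2) ^+ m.
Proof.
move=> d0 /andP[dt t2].
have cosk (x : R) : cos (pi * x) ^+ 2 = cos (pi * (x - k%:~R)) ^+ 2.
  have cosn (n : nat) (y : R) : cos (pi * (y - n%:R)) ^+ 2 = cos (pi * y) ^+ 2.
    elim: n y => [|n IH] y; first by rewrite subr0.
    rewrite -[RHS]IH -[LHS]sqrrN -cosDpi; congr (cos _ ^+ 2 : R).
    by rewrite -natr1; ring.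
  case: k {dt t2} => n; first by rewrite cosn.
  rewrite NegzE mulrNz opprK -[RHS](cosn n.+1); congr (cos _ ^+ 2 : R).
  by rewrite -[n.+1%:~R]/(n.+1%:R); ring.
rewrite /trig_kernel -[X in cos _ ^+ X]mul2n exprM.
apply: ler_pM => //.
- by rewrite exprn_ge0// sqr_ge0.
- exact: bin_central_ge.
apply: lerXn2r; rewrite ?nnegrE ?sqr_ge0//.
rewrite cosk; set y := t - k%:~R in dt t2 *.
have -> : cos (pi * y) = cos (pi * `|y|).
  by have [//|y0] := ger0P y; rewrite mulrN cosN.
have pi0 := pi_gt0 R.
apply: lerXn2r; rewrite ?nnegrE.
- apply: cos_ge0_pihalf; rewrite ler_pM2l// t2 andbT.
  by rewrite (@le_trans _ _ 0)// ?oppr_le0 ?mulr_ge0 ?divr_ge0// ltW.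
- apply: cos_ge0_pihalf; rewrite ler_pM2l// (le_trans dt t2) andbT.
  by rewrite (@le_trans _ _ 0)// ?oppr_le0 ?mulr_ge0 ?divr_ge0// ltW.
have [->//|ny] := eqVneq d `|y|.
apply/ltW; rewrite ltr_cos ?in_itv/=.
- by rewrite ltr_pM2l// lt_neqAle ny.
- by apply/andP; split; nra.
- by apply/andP; split; nra.
Qed.

Lemma linear_geometric_small (q e : R) : 0 <= q < 1 -> 0 < e ->
  \forall m \near \oo, m.*2.+1%:R * q ^+ m <= e.
Proof.
move=> /andP[q0 q1] e0.
(* [q <= s ^+ 2] by AM-GM, and [m.*2.+1%:R * s ^+ m] is bounded by Bernoulli. *)
pose s := (1 + q) / 2; have s0 : 0 < s by rewrite /s; lra.
have s1 : s < 1 by rewrite /s; lra.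
have qs : q <= s ^+ 2 by have := sqr_ge0 (1 - q); rewrite /s; nra.
pose K := 2 / (s^-1 - 1) + 1.
have r0 : 0 < s^-1 - 1 by rewrite subr_gt0 invf_gt1.
have K0 : 0 < K by rewrite /K addr_gt0// divr_gt0.
have mK m : m.*2.+1%:R * s ^+ m <= K.
  rewrite -[s]invrK exprVn ler_pdivrMr ?exprn_gt0 ?invr_gt0//.
  have : 1 + m%:R * (s^-1 - 1) <= s^-1 ^+ m.
    elim: m => [|m IH]; first by rewrite mul0r addr0.
    rewrite exprS -natr1.
    have : 0 <= m%:R * (s^-1 - 1) ^+ 2 by rewrite mulr_ge0 ?sqr_ge0.
    have : 1 <= s^-1 by rewrite ltW// -subr_gt0.
    nra.
  move=> /(ler_wpM2l (ltW K0)); apply: le_trans.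
  have -> : K * (1 + m%:R * (s^-1 - 1)) =
      2 / (s^-1 - 1) + (m.*2.+1%:R + m%:R * (s^-1 - 1)).
    rewrite -[m.*2.+1%:R]natr1 -muln2 natrM /K; move: (s^-1 - 1) r0 => r r0'.
    by field; rewrite gt_eqF.
  have : 0 <= 2 / (s^-1 - 1) by rewrite divr_ge0// ltW.
  have : 0 <= m%:R * (s^-1 - 1) by apply: mulr_ge0; rewrite // ltW.
  by lra.
have : (fun m => s ^+ m) @ \oo --> (0 : R) by apply: cvg_expr; rewrite ger0_norm// ltW.
move/cvgr0_norm_le => /(_ (e / K)); rewrite divr_gt0// => /(_ isT).
have s0' := ltW s0.
apply: filterS => m; rewrite ger0_norm ?exprn_ge0// => sm.
apply: (@le_trans _ _ (m.*2.+1%:R * (s ^+ m * s ^+ m))).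
  rewrite ler_wpM2l// -exprMn -expr2; apply: lerXn2r; rewrite ?nnegrE ?sqr_ge0//.
rewrite mulrA (@le_trans _ _ (K * (e / K)))//; last by rewrite mulrCA mulfV ?mulr1// gt_eqF.
by apply: ler_pM => //; rewrite ?mulr_ge0 ?exprn_ge0.
Qed.

Lemma continuous_trig_kernel_exp m h (k : R) :
  continuous (fun t => trig_kernel m (t / h) * expR (- (k * `|t|))).
Proof.
move=> t; apply: cvgM; first exact: continuous_trig_kernel.
apply: (@continuous_comp _ _ _ (fun t => - (k * `|t|)) expR); last exact: continuous_expR.
by apply: cvgN; apply: cvgM; [exact: cvg_cst|exact: norm_continuous].
Qed.

(** The bound is free of [m]: on the n-th period the exponential is at most q^n with q = exp(-kh),
    and the kernel has mass h there. Evenness reduces the line to the half-line, whence the factor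
    2. *)
Lemma integral_trig_kernel_exp m h (k : R) : 0 < h -> 0 < k ->
  (\int[lebesgue_measure]_t (trig_kernel m (t / h) * expR (- (k * `|t|)))%:E
   <= (2 * (h + k^-1))%:E)%E.
Proof.
move=> h0 k0.
have cf := @continuous_trig_kernel_exp m h k.
rewrite ge0_symfun_integralT//; last 2 first.
- by move=> x; rewrite mulr_ge0 ?expR_ge0 ?trig_kernel_ge0.
- by move=> x; rewrite /= mulNr trig_kernelN normrN.
rewrite EFinM lee_pmul2l//.
pose I (n : nat) : set R := `[(n%:R * h), (n%:R * h + h)[%classic.
have IE : [set x : R | 0 <= x] = \bigcup_n I n.
  apply/seteqP; split => [x/= x0|x [n _]]; last first.
    by rewrite /I/= in_itv/= => /andP[+ _]; apply: le_trans; rewrite mulr_ge0// ltW.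
  have /truncn_itv/andP[] : 0 <= x / h by rewrite divr_ge0// ltW.
  rewrite ler_pdivlMr// ltr_pdivrMr// => x1 x2.
  by exists (Num.trunc (x / h)) => //; rewrite /I/= in_itv/= x1/=; move: x2; rewrite -natr1 mulrDl mul1r.
have mI n : measurable (I n) by exact: measurable_itv.
have mf := continuous_measurable_fun cf.
rewrite IE ge0_integral_bigcup//; last 3 first.
- by apply/measurable_EFinP; apply: measurable_funTS.
- by move=> x _; rewrite lee_fin mulr_ge0 ?expR_ge0 ?trig_kernel_ge0.
- apply/trivIsetP => i j _ _ ij; rewrite -subset0 => x [].
  rewrite /I/= !in_itv/= => /andP[i1 i2] /andP[j1 j2].
  have aux (a b : nat) : (a < b)%N -> x < a%:R * h + h -> b%:R * h <= x -> False.
    move=> ab xa bx; have : a.+1%:R * h <= b%:R * h by rewrite ler_pM2r// ler_nat.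
    by rewrite -natr1 mulrDl mul1r; lra.
  by case: (ltngtP i j) ij => // ij _; [exact: (aux i j)|exact: (aux j i)].
pose q := expR (- (k * h)).
have q1 : q < 1 by rewrite expR_lt1 oppr_lt0 mulr_gt0.
have q0 : 0 < q by exact: expR_gt0.
have Ib n : (\int[lebesgue_measure]_(t in I n)
    (trig_kernel m (t / h) * expR (- (k * `|t|)))%:E <= (geometric h q n)%:E)%E.
  apply: (@le_trans _ _ (\int[lebesgue_measure]_(t in I n)
    ((q ^+ n)%:E * (trig_kernel m (t / h))%:E))%E).
    apply: ge0_le_integral => //.
    - exact: mI.
    - by move=> x _; rewrite lee_fin mulr_ge0 ?expR_ge0 ?trig_kernel_ge0.
    - by apply/measurable_EFinP; apply: measurable_funTS.
    - apply/measurable_EFinP; apply: measurable_funM => //; apply: measurable_funTS.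
      exact: measurable_trig_kernel.
    - move=> x; rewrite /I/= in_itv/= => /andP[nx _].
      rewrite lee_fin mulrC ler_wpM2r ?trig_kernel_ge0// -expRM_natl ler_expR.
      rewrite mulrN lerN2 mulrCA ler_pM2l//.
      exact: le_trans (ler_norm x).
  rewrite ge0_integralZl//; last 4 first.
  - exact: mI.
  - apply/measurable_EFinP; apply: measurable_funTS.
    exact: measurable_trig_kernel.
  - by move=> x _; rewrite lee_fin trig_kernel_ge0.
  - by rewrite lee_fin exprn_ge0// ltW.
  by rewrite integral_trig_kernel// -EFinM mulrC.
apply: lime_le; first by apply: is_cvg_nneseries => n _ _;
  apply: integral_ge0 => x _; rewrite lee_fin mulr_ge0 ?expR_ge0 ?trig_kernel_ge0.
apply: nearW => n; apply: (le_trans (lee_sum _ (fun i _ => Ib i))).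
rewrite sumEFin lee_fin.
apply: (@le_trans _ _ (h / (1 - q))).
  by apply: geometric_le_lim; rewrite ?ltW// ger0_norm// ltW.
rewrite ler_pdivrMr ?subr_gt0//.
(* This is exp(kh) >= 1 + kh, which turns the geometric sum h / (1 - q) into the bound h + 1/k. *)
have : q * (1 + k * h) <= 1.
  have := expR_ge1Dx (k * h); rewrite -(ler_pM2l q0) => /le_trans; apply.
  by rewrite -expRD addNr expR0.
move=> qkh; have : (1 + k * h) / k * (1 - q) >= h.
  rewrite mulrAC ler_pdivlMr//; nra.
by rewrite mulrDl mul1r mulrAC mulfV ?gt_eqF// mul1r addrC.
Qed.

End trig_kernel.

(** * Essential suprema and Fourier transforms of continuous functions *)

Section rV_analysis.
Context {R : realType}.
Local Notation mu n := (@lebesgue_rV R n).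

Lemma measurable_rV_box n (A : 'I_n -> set (measurableTypeR R)) :
  (forall i, measurable (A i)) ->
  measurable [set x : 'rV[R]_n | forall i, A i (x ord0 i)].
Proof.
move=> mA.
have -> : [set x : 'rV[R]_n | forall i, A i (x ord0 i)] =
    \bigcap_(i in [set: 'I_n]) (coord_rV i @^-1` A i).
  by apply/seteqP; split => x xB i => [_|]; exact: xB.
apply: fin_bigcap_measurable => // i _; rewrite -[X in measurable X]setTI.
exact: (@measurable_coord_rV _ R n i measurableT (A i) (mA _)).
Qed.

(** A null set cannot contain an open box, since boxes have positive measure. This is the passage
    from almost everywhere to everywhere for continuous functions. *)
Lemma ae_rV_dense n (P : set 'rV[R]_n) : (\forall x \ae mu n, P x) ->
  forall (x : 'rV[R]_n) (e : R), 0 < e ->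
  exists2 y, P y & forall i, `|x ord0 i - y ord0 i| < e.
Proof.
move=> [N [mN N0 PN]] x e e0; apply: contrapT => nP.
pose A (i : 'I_n) : set (measurableTypeR R) := `](x ord0 i - e), (x ord0 i + e)[%classic.
have mA i : measurable (A i) by exact: measurable_itv.
have : (mu n [set y : 'rV[R]_n | forall i, A i (y ord0 i)] <= mu n N)%E.
  apply: le_measure; rewrite ?inE//; first exact: measurable_rV_box.
  move=> y /= yA; apply: PN => Py; apply: nP; exists y => // i.
  by have := yA i; rewrite /A/= in_itv/= ltr_distl andbC ltrBlDr ltrBlDr.
rewrite N0 lebesgue_rV_box// leNgt => /negP; apply.
elim/big_ind : _ => // [a b a0 b0|i _]; first by rewrite mule_gt0.
by rewrite /A lebesgue_measure_itv/= lte_fin ltrD2l gtrN//= -EFinB lte_fin; lra.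
Qed.

Lemma lebesgue_rV_gt0 n : (0 < mu n [set: 'rV[R]_n])%E.
Proof.
rewrite lt0e measure_ge0 andbT; apply/eqP => mu0.
have : \forall x \ae mu n, False by exists setT; split.
by move=> /ae_rV_dense /(_ 0 1 ltr01)[].
Qed.

Lemma Lnorm_oo_seq n (g : 'rV[R]_n -> R) (F : R) (x : 'rV[R]_n) :
  ('N[mu n]_+oo[EFin \o g] <= F%:E)%E ->
  exists2 y : nat -> 'rV[R]_n, (y @ \oo --> x) & forall k, `|g (y k)| <= F.
Proof.
rewrite unlock /Lnorm lebesgue_rV_gt0 => /ess_supP gF.
have /choice[y yP] : forall k : nat, exists y : 'rV[R]_n,
    `|g y| <= F /\ forall i, `|x ord0 i - y ord0 i| < k.+1%:R^-1.
  move=> k; have k0 : 0 < k.+1%:R^-1 :> R by rewrite invr_gt0.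
  by have [y gy yx] := ae_rV_dense gF x k0; exists y; split => //; rewrite -lee_fin.
exists y; last by move=> k; have [] := yP k.
apply/cvg_ballP => e e0.
near=> k; split => // i j; rewrite (ord1 i).
have [_ /(_ j)] := yP k; rewrite /ball/= => /lt_trans; apply.
by near: k; exact: near_infty_natSinv_lt (PosNum e0).
Unshelve. all: end_near. Qed.

Lemma continuous_norm_powR (p : R) : 0 < p -> continuous (fun t : R => `|t| `^ p).
Proof.
move=> p0 t; have [->|t0] := eqVneq t 0.
  rewrite /continuous_at normr0 powR0 ?gt_eqF//; apply/cvgrPdist_le => e e0.
  suff : \forall u \near (0 : R), `|0 - `|u| `^ p| <= e by [].
  near=> u; have ue : `|u| < e `^ p^-1.
    near: u; apply/nbhs_ballP; exists (e `^ p^-1); first exact: powR_gt0.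
    by move=> z; rewrite /ball/= sub0r normrN.
  rewrite sub0r normrN ger0_norm ?powR_ge0//.
  have -> : e = (e `^ p^-1) `^ p by rewrite -powRrM mulVf ?gt_eqF// powRr1// ltW.
  by rewrite ge0_ler_powR ?nnegrE ?powR_ge0//; exact: ltW.
apply: (@continuous_comp _ _ _ (fun t : R => `|t|) (fun t : R => t `^ p)).
  exact: norm_continuous.
by apply: continuous_powR; rewrite normr_gt0.
Unshelve. all: by end_near. Qed.

Lemma cvg_bigsum (T I : Type) (F : set_system T) {FF : Filter F} (r : seq I)
    (f : I -> T -> R) (l : I -> R) : (forall i, f i @ F --> l i) ->
  (fun x => \sum_(i <- r) f i x) @ F --> \sum_(i <- r) l i.
Proof.
move=> fl; elim: r => [|i r IH].
  by under eq_fun do rewrite big_nil; rewrite big_nil; exact: cvg_cst.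
by under eq_fun do rewrite big_cons; rewrite big_cons; exact: cvgD.
Qed.

Lemma continuous_sum_rV n (g : 'I_n -> R -> R) : (forall i, continuous (g i)) ->
  continuous (fun x : 'rV[R]_n => \sum_(i < n) g i (x ord0 i)).
Proof.
move=> cg x; apply: (@cvg_bigsum _ _ (nbhs x) _ _ (fun i x => g i (x ord0 i))) => i.
by apply: (@continuous_comp _ _ _ (fun x : 'rV[R]_n => x ord0 i) (g i));
  [exact: coord_continuous|exact: cg].
Qed.

Lemma Lnorm_oo_weight n (f w : 'rV[R]_n -> R) (F : R) :
  continuous f -> continuous w -> (forall x, 0 <= w x) ->
  ('N[mu n]_+oo[EFin \o (fun x => f x * w x)%R] <= F%:E)%E ->
  forall x, `|f x| * w x <= F.
Proof.
move=> cf cw w0 fwF x; have [y yx yF] := Lnorm_oo_seq x fwF.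
rewrite -(ger0_norm (w0 x)) -normrM.
suff H : (fun k => `|f (y k) * w (y k)|) @ \oo --> `|f x * w x|.
  by apply: (cvgr_to_le H); exact: nearW.
apply: cvg_norm; apply: cvgM.
  by apply: (@continuous_cvg _ _ _ _ _ y f x) => //; exact: cf.
by apply: (@continuous_cvg _ _ _ _ _ y w x) => //; exact: cw.
Qed.

Lemma normc_ge_normRe (z : R[i]) : `|complex.Re z| <= ComplexField.Normc.normc z.
Proof. by case: z => a b /=; rewrite -sqrtr_sqr ler_wsqrtr// lerDl sqr_ge0. Qed.

(** Real part of the Fourier transform. It suffices for real [f], because the expansion of the
    kernel is a real combination of cosines. *)
Definition fourier_cos n (f : 'rV[R]_n -> R) (xi : 'rV[R]_n) : R :=
  \int[mu n]_x (f x * cos (2 * pi * \sum_(j < n) xi ord0 j * x ord0 j)).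

Lemma Re_fourier n (f : 'rV[R]_n -> R) xi :
  complex.Re (fourier f xi) = fourier_cos f xi.
Proof.
rewrite /fourier /Cintegral/=; apply: eq_Rintegral => x _.
by rewrite cosN mul0r subr0.
Qed.

Lemma measurable_cos_rV n (xi : 'rV[R]_n) :
  measurable_fun [set: 'rV[R]_n]
    (fun x : 'rV[R]_n => cos (2 * pi * \sum_(j < n) xi ord0 j * x ord0 j)).
Proof.
apply: (@measurableT_comp _ _ _ _ _ _ (@cos R)).
  by apply: continuous_measurable_fun; exact: continuous_cos.
apply: measurable_funM => //; apply: measurable_sum => j.
by apply: measurable_funM => //; exact: measurable_coord_rV.
Qed.

(** Dominated convergence with majorant |f|. Continuity along sequences is what is required to pass
    to the limit in [Lnorm_oo_seq]. *)
Lemma fourier_cos_seq n (f : 'rV[R]_n -> R) (y : nat -> 'rV[R]_n) xi :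
  (mu n).-integrable setT (EFin \o f) -> y @ \oo --> xi ->
  (fun k => fourier_cos f (y k)) @ \oo --> fourier_cos f xi.
Proof.
move=> fi yxi; have [mf _] := integrableP _ _ _ fi.
have mF (z : 'rV[R]_n) : measurable_fun setT (fun x : 'rV[R]_n =>
    (f x * cos (2 * pi * \sum_(j < n) z ord0 j * x ord0 j))%:E).
  apply/measurable_EFinP/measurable_funM; last exact: measurable_cos_rV.
  by move/measurable_EFinP : mf.
have Fle (z x : 'rV[R]_n) : (`|(f x * cos (2 * pi * \sum_(j < n) z ord0 j * x ord0 j))%:E|
    <= `|(EFin \o f) x|)%E.
  rewrite lee_fin normrM -[leRHS]mulr1 ler_wpM2l// ler_norml.
  by rewrite cos_geN1 cos_le1.
have cF (x : 'rV[R]_n) : (fun k => (f x * cos (2 * pi * \sum_(j < n) y k ord0 j * x ord0 j))%:E)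
    @ \oo --> (f x * cos (2 * pi * \sum_(j < n) xi ord0 j * x ord0 j))%:E.
  apply: cvg_EFin; first exact: nearW.
  apply: cvgM; first exact: cvg_cst.
  apply: (@continuous_cvg _ _ _ _ _ (fun k => 2 * pi * \sum_(j < n) y k ord0 j * x ord0 j) (@cos R)); first exact: continuous_cos.
  apply: cvgM; first exact: cvg_cst.
  apply: cvg_bigsum => j; apply: cvgM; last exact: cvg_cst.
  by apply: (@continuous_cvg _ _ _ _ _ y (fun z : 'rV[R]_n => z ord0 j) xi) => //;
    exact: coord_continuous.
have [Fi _ H] := dominated_convergence measurableT (fun k => mF (y k)) (mF xi)
  (aeW _ (fun x _ => cF x)) (integrable_abse fi)
  (aeW _ (fun x k _ => Fle (y k) x)).
have := fine_cvg; apply.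
rewrite fineK//; exact: integrable_fin_num Fi.
Qed.

Lemma fourier_cos_le n (f w : 'rV[R]_n -> R) (G : R) :
  (mu n).-integrable setT (EFin \o f) -> continuous w -> (forall x, 0 <= w x) ->
  ('N[mu n]_+oo[EFin \o (fun xi =>
      ComplexField.Normc.normc (fourier f xi * (w xi)%:C%C))%R] <= G%:E)%E ->
  forall xi, `|fourier_cos f xi| * w xi <= G.
Proof.
move=> fi cw w0 fwG xi; have [y yx yG] := Lnorm_oo_seq xi fwG.
rewrite -(ger0_norm (w0 xi)) -normrM.
suff H : (fun k => `|fourier_cos f (y k) * w (y k)|) @ \oo -->
    `|fourier_cos f xi * w xi|.
  apply: (cvgr_to_le H); apply: nearW => k; apply: le_trans (yG k).
  rewrite [leRHS]ger0_norm; last by case: (_ * _) => a b; exact: sqrtr_ge0.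
  apply: le_trans (normc_ge_normRe _); rewrite -Re_fourier.
  by case: (fourier f (y k)) => a b; rewrite /= mulr0 subr0.
apply: cvg_norm; apply: cvgM; first exact: fourier_cos_seq.
by apply: (@continuous_cvg _ _ _ _ _ y w xi) => //; exact: cw.
Qed.

End rV_analysis.

(** * Linearity, domination and product formulas for integrals over row vectors *)

Section rV_integrals.
Context {R : realType}.
Local Notation mu n := (@lebesgue_rV R n).
Local Notation rV_integrable n f := ((mu n).-integrable [set: 'rV[R]_n] (EFin \o f)).

Lemma integrable_bigsum n (I : Type) (r : seq I) (F : I -> 'rV[R]_n -> R) :
  (forall i, rV_integrable n (F i)) ->
  rV_integrable n (fun x => \sum_(i <- r) F i x).
Proof.
move=> Fi; rewrite (_ : EFin \o _ = fun x => (\sum_(i <- r) (F i x)%:E)%E).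
  by apply: integrable_sum => // i _; exact: Fi.
by apply/funext => x; rewrite /= sumEFin.
Qed.

Lemma Rintegral_bigsum n (I : Type) (r : seq I) (F : I -> 'rV[R]_n -> R) :
  (forall i, rV_integrable n (F i)) ->
  \int[mu n]_x (\sum_(i <- r) F i x) = \sum_(i <- r) \int[mu n]_x F i x.
Proof.
move=> Fi; elim: r => [|i r IH].
  rewrite big_nil; under eq_Rintegral do rewrite big_nil.
  by rewrite Rintegral_cst// mul0r.
rewrite big_cons -IH -RintegralD//; last exact: integrable_bigsum.
by apply: eq_Rintegral => x _; rewrite big_cons.
Qed.

Lemma integrable_scale n (c : R) (F : 'rV[R]_n -> R) :
  rV_integrable n F -> rV_integrable n (fun x => c * F x).
Proof.
move=> Fi; rewrite (_ : EFin \o _ = fun x => (c%:E * (F x)%:E)%E)//.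
exact: integrableZl.
Qed.

Lemma integrable_addR n (F G : 'rV[R]_n -> R) :
  rV_integrable n F -> rV_integrable n G -> rV_integrable n (fun x => F x + G x).
Proof. by move=> Fi Gi; exact: (integrableD measurableT Fi Gi). Qed.

Lemma integrable_subR n (F G : 'rV[R]_n -> R) :
  rV_integrable n F -> rV_integrable n G -> rV_integrable n (fun x => F x - G x).
Proof. by move=> Fi Gi; exact: (integrableB measurableT Fi Gi). Qed.

Lemma integrable_dominated n (F G : 'rV[R]_n -> R) :
  measurable_fun [set: 'rV[R]_n] F -> (forall x, `|F x| <= `|G x|) ->
  rV_integrable n G -> rV_integrable n F.
Proof.
move=> mF FG; apply: le_integrable => //; first exact/measurable_EFinP.
by move=> x _; rewrite lee_fin.
Qed.

Lemma measurable_rV_prod n (G : 'I_n -> R -> R) :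
  (forall i, measurable_fun [set: R] (G i)) ->
  measurable_fun [set: 'rV[R]_n] (fun x : 'rV[R]_n => \prod_(i < n) G i (x ord0 i)).
Proof.
move=> mG; apply: measurable_prod => i _.
exact: (measurableT_comp (mG i) (measurable_coord_rV i)).
Qed.

Lemma integrable_rV_prod n (G : 'I_n -> R -> R) (v : 'I_n -> R) :
  (forall i, measurable_fun [set: R] (G i)) -> (forall i t, 0 <= G i t) ->
  (forall i, \int[lebesgue_measure]_t (G i t)%:E = (v i)%:E)%E ->
  rV_integrable n (fun x => \prod_(i < n) G i (x ord0 i)).
Proof.
move=> mG G0 Gv; apply/integrableP; split.
  by apply/measurable_EFinP; exact: measurable_rV_prod.
under eq_integral do rewrite /= ger0_norm ?prodr_ge0//.
rewrite ge0_integral_prod_rV//; under eq_bigr do rewrite Gv.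
by rewrite prodEFin ltry.
Qed.

Lemma Rintegral_rV_prod n (G : 'I_n -> R -> R) (v : 'I_n -> R) :
  (forall i, measurable_fun [set: R] (G i)) -> (forall i t, 0 <= G i t) ->
  (forall i, \int[lebesgue_measure]_t (G i t)%:E = (v i)%:E)%E ->
  \int[mu n]_x (\prod_(i < n) G i (x ord0 i)) = \prod_(i < n) v i.
Proof.
move=> mG G0 Gv; rewrite /Rintegral ge0_integral_prod_rV//.
by under eq_bigr do rewrite Gv; rewrite prodEFin.
Qed.

End rV_integrals.

(** * Integration against the kernel and the aliasing sum *)

Section aliasing.
Context {R : realType} {n : nat}.
Variables (h : 'I_n -> R) (m : nat) (f : 'rV[R]_n -> R).
Local Notation mu := (@lebesgue_rV R n).
Hypothesis fi : mu.-integrable [set: 'rV[R]_n] (EFin \o f).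

Definition rV_kernel (x : 'rV[R]_n) : R := \prod_(j < n) trig_kernel m (x ord0 j / h j).

Lemma rV_kernel_ge0 x : 0 <= rV_kernel x.
Proof. by apply: prodr_ge0 => j _; exact: trig_kernel_ge0. Qed.

Let freq (g : {ffun 'I_n -> 'I_m.*2.+1}) : 'rV[R]_n :=
  \row_j (((g j)%:R - m%:R) / h j).

Let f_kernelE x : f x * rV_kernel x =
  \sum_(g : {ffun 'I_n -> 'I_m.*2.+1}) (\prod_j kernel_coef m (g j)) *
    (f x * cos (2 * pi * \sum_(j < n) freq g ord0 j * x ord0 j)).
Proof.
rewrite /rV_kernel trig_kernel_prod mulr_sumr; apply: eq_bigr => g _.
rewrite mulrCA; congr (_ * (_ * cos (_ * _))); apply: eq_bigr => j _.
by rewrite mxE mulrA mulrAC.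
Qed.

Lemma integrable_fcos (xi : 'rV[R]_n) : mu.-integrable [set: 'rV[R]_n]
  (EFin \o (fun x => f x * cos (2 * pi * \sum_(j < n) xi ord0 j * x ord0 j))).
Proof.
have [/measurable_EFinP mf _] := integrableP _ _ _ fi.
apply: integrable_dominated fi.
  by apply: measurable_funM => //; exact: measurable_cos_rV.
by move=> x; rewrite normrM -[leRHS]mulr1 ler_wpM2l// ler_norml cos_geN1 cos_le1.
Qed.

Lemma integrable_f_kernel : mu.-integrable [set: 'rV[R]_n]
  (EFin \o (fun x => f x * rV_kernel x)).
Proof.
under [fun x => f x * _]eq_fun do rewrite f_kernelE.
by apply: integrable_bigsum => g; apply: integrable_scale; exact: integrable_fcos.
Qed.

Lemma integral_f_kernel : \int[mu]_x (f x * rV_kernel x) =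
  \sum_(g : {ffun 'I_n -> 'I_m.*2.+1}) (\prod_j kernel_coef m (g j)) *
    fourier_cos f (freq g).
Proof.
under eq_Rintegral do rewrite f_kernelE.
rewrite Rintegral_bigsum; last first.
  by move=> g; apply: integrable_scale; exact: integrable_fcos.
by apply: eq_bigr => g _; rewrite RintegralZl//; exact: integrable_fcos.
Qed.

(** The constant function [g0] gives frequency 0, hence the integral of [f] with coefficient 1.
    Every other coefficient lies in [0,1], and since [rho j 0 = 1], expanding the product of
    one-dimensional sums and subtracting 1 leaves exactly the majorants of the other terms. *)
Lemma aliasing_le (G : R) (rho : 'I_n -> R -> R) : 0 <= G ->
  (forall j t, 0 <= rho j t) -> (forall j, rho j 0 = 1) ->
  (forall xi, `|fourier_cos f xi| <= G * \prod_(j < n) rho j (xi ord0 j)) ->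
  `|\int[mu]_x (f x * rV_kernel x) - \int[mu]_x f x| <=
  G * (\prod_(j < n) \sum_(i < m.*2.+1) rho j ((i%:R - m%:R) / h j) - 1).
Proof.
move=> G0 r0 r1 fr.
have mm : (m < m.*2.+1)%N by rewrite ltnS -addnn leq_addr.
pose g0 : {ffun 'I_n -> 'I_m.*2.+1} := [ffun=> Ordinal mm].
have freq0 : freq g0 = 0.
  by apply/rowP => j; rewrite !mxE ffunE/= subrr mul0r.
have fc0 : fourier_cos f 0 = \int[mu]_x f x.
  apply: eq_Rintegral => x _; rewrite big1 ?mulr0 ?cos0 ?mulr1// => j _.
  by rewrite mxE mul0r.
rewrite integral_f_kernel bigA_distr_bigA/= (bigD1 g0)//= [in leRHS](bigD1 g0)//=.
rewrite freq0 fc0 big1 ?mul1r; last by move=> j _; rewrite ffunE/= kernel_coef_mid.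
rewrite [X in _ * (X + _ - _)]big1; last by move=> j _; rewrite ffunE/= subrr mul0r r1.
rewrite !(addrAC _ _ (- _)) !subrr !add0r mulr_sumr.
apply: le_trans (ler_norm_sum _ _ _) _; apply: ler_sum => g _.
rewrite normrM ger0_norm; last by apply: prodr_ge0 => j _; exact: kernel_coef_ge0.
rewrite -[leRHS]mul1r; apply: ler_pM => //.
- by apply: prodr_ge0 => j _; exact: kernel_coef_ge0.
- by apply: prodr_ile1 => j _; rewrite kernel_coef_ge0 kernel_coef_le1.
- by apply: le_trans (fr _) _; rewrite le_eqVlt; apply/orP; left; apply/eqP;
    congr (_ * _); apply: eq_bigr => j _; rewrite mxE.
Qed.

End aliasing.

(** * Cells around the nodes *)

Section cells.
Context {R : realType}.
Implicit Types (h t u : R) (k : int).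

(** Half-open cell of width h centred at kh. Rounding by the floor puts every point in exactly one
    cell, so no overlaps have to be discussed. *)
Definition in_cell h k t : bool := Num.floor (t / h + 2^-1) == k.

Lemma in_cellP h k t : 0 < h ->
  in_cell h k t = (t \in `[((k%:~R - 2^-1) * h), ((k%:~R - 2^-1) * h + h)[).
Proof.
move=> h0; rewrite /in_cell floor_eq in_itv/=.
have -> : (k%:~R - 2^-1) * h + h = (k%:~R + 2^-1) * h by field.
rewrite -ler_pdivlMr// -ltr_pdivrMr// intrD.
by apply/andP/andP => -[k1 k2]; split; lra.
Qed.

Lemma in_cell_dist h k t : in_cell h k t -> `|t / h - k%:~R| <= 2^-1.
Proof.
rewrite /in_cell floor_eq intrD => /andP[k1 k2].
by rewrite ler_norml; apply/andP; split; lra.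
Qed.

Lemma measurable_in_cell h k : 0 < h ->
  measurable_fun [set: R] (fun t => (in_cell h k t)%:R : R).
Proof.
move=> h0; rewrite (_ : (fun t => _) =
  \1_(`[((k%:~R - 2^-1) * h), ((k%:~R - 2^-1) * h + h)[%classic)); last first.
  apply/funext => t; rewrite in_cellP// indicE; congr (nat_of_bool _)%:R.
  by apply/idP/idP; rewrite inE.
by apply: measurable_indic; exact: measurable_itv.
Qed.

Lemma integral_in_cell h k (F : R -> R) : 0 < h ->
  (\int[lebesgue_measure]_t (F t * (in_cell h k t)%:R)%:E =
   \int[lebesgue_measure]_(t in `[((k%:~R - 2^-1) * h)%R, ((k%:~R - 2^-1) * h + h)%R[) (F t)%:E)%E.
Proof.
move=> h0; rewrite [RHS]integral_mkcond; apply: eq_integral => t _.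
rewrite patchE in_cellP//; case: ifPn => ht.
  by move: ht; rewrite inE/= => ->; rewrite mulr1.
by move: ht; rewrite notin_setE/= => /negP/negPf ->; rewrite mulr0.
Qed.

Lemma integral_kernel_cell m h k : 0 < h ->
  (\int[lebesgue_measure]_t (trig_kernel m (t / h) * (in_cell h k t)%:R)%:E = h%:E)%E.
Proof. by move=> h0; rewrite integral_in_cell// integral_trig_kernel. Qed.

Lemma integral_cell (c : R) h k : 0 < h ->
  (\int[lebesgue_measure]_t (c * (in_cell h k t)%:R)%:E = (c * h)%:E)%E.
Proof.
move=> h0; rewrite (integral_in_cell k (fun=> c))//.
have mI : measurable (`[((k%:~R - 2^-1) * h)%R, ((k%:~R - 2^-1) * h + h)%R[%classic : set R).
  exact: measurable_itv.
rewrite (integral_cst lebesgue_measure mI c%:E) EFinM; congr (_ * _)%E.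
rewrite [LHS](lebesgue_measure_itv `[((k%:~R - 2^-1) * h)%R, ((k%:~R - 2^-1) * h + h)%R[) /=.
by rewrite lte_fin ltrDl h0 -EFinB addrAC subrr add0r.
Qed.

End cells.

Section cell_integral.
Context {R : realType} {n : nat}.
Variables (h : 'I_n -> R) (m : nat) (f : 'rV[R]_n -> R) (F0 : R).
Local Notation mu := (@lebesgue_rV R n).
Hypotheses (h0 : forall j, 0 < h j)
  (fi : mu.-integrable [set: 'rV[R]_n] (EFin \o f))
  (fF : forall x, `|f x| <= F0).

Definition node (k : 'I_n -> int) : 'rV[R]_n := \row_j ((k j)%:~R * h j).

Definition kernel_cell (k : 'I_n -> int) (x : 'rV[R]_n) : R :=
  \prod_(j < n) (trig_kernel m (x ord0 j / h j) * (in_cell (h j) (k j) (x ord0 j))%:R).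

Lemma kernel_cellE k x : kernel_cell k x =
  rV_kernel h m x * \prod_(j < n) (in_cell (h j) (k j) (x ord0 j))%:R.
Proof. by rewrite /kernel_cell big_split. Qed.

Lemma kernel_cell_ge0 k x : 0 <= kernel_cell k x.
Proof. by apply: prodr_ge0 => j _; rewrite mulr_ge0 ?trig_kernel_ge0. Qed.

Let mKc k j : measurable_fun [set: R]
  (fun t : R => trig_kernel m (t / h j) * (in_cell (h j) k t)%:R).
Proof. by apply: measurable_funM; [exact: measurable_trig_kernel|exact: measurable_in_cell]. Qed.

Let Kc_ge0 k j (t : R) : 0 <= trig_kernel m (t / h j) * (in_cell (h j) k t)%:R.
Proof. by rewrite mulr_ge0 ?trig_kernel_ge0. Qed.

Lemma integrable_kernel_cell k : mu.-integrable [set: 'rV[R]_n] (EFin \o kernel_cell k).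
Proof.
apply: (@integrable_rV_prod _ _
  (fun j t => trig_kernel m (t / h j) * (in_cell (h j) (k j) t)%:R) h) => // j.
exact: integral_kernel_cell.
Qed.

Lemma integral_kernel_cell_rV k : \int[mu]_x kernel_cell k x = \prod_(j < n) h j.
Proof.
rewrite (@Rintegral_rV_prod _ _
  (fun j t => trig_kernel m (t / h j) * (in_cell (h j) (k j) t)%:R) h) => // j.
exact: integral_kernel_cell.
Qed.

Lemma integrable_f_kernel_cell k :
  mu.-integrable [set: 'rV[R]_n] (EFin \o (fun x => f x * kernel_cell k x)).
Proof.
have [/measurable_EFinP mf _] := integrableP _ _ _ fi.
apply: integrable_dominated (integrable_scale F0 (integrable_kernel_cell k)).
  apply: measurable_funM => //.
  by have [/measurable_EFinP] := integrableP _ _ _ (integrable_kernel_cell k).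
move=> x; rewrite !normrM ler_wpM2r//.
by rewrite (le_trans (fF x))// ler_norm.
Qed.

(** The kernel has mass h_1...h_n on the cell, so the difference is the integral of f(x) - f(node)
    against it. Points close to the node in all coordinates contribute the [e] term; any other point
    is at distance at least [d] in some coordinate, where that factor of the kernel is at most [th]
    and |f(x) - f(node)| <= 2 [F0]. *)
Lemma cell_integral (k : 'I_n -> int) (e d : R) : 0 <= e -> 0 <= d ->
  (forall x : 'rV[R]_n, (forall j, `|x ord0 j / h j - (k j)%:~R| < d) ->
    `|f x - f (node k)| <= e) ->
  `|\int[mu]_x (f x * kernel_cell k x) - (\prod_(j < n) h j) * f (node k)| <=
  (e + 2 * F0 * (n%:R * (m.*2.+1%:R * (cos (pi * d) ^+ 2) ^+ m))) * \prod_(j < n) h j.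
Proof.
move=> e0 d0 fe; set th := m.*2.+1%:R * _; set H := \prod_(j < n) h j.
have th0 : 0 <= th by rewrite mulr_ge0// exprn_ge0// sqr_ge0.
have F00 : 0 <= F0 by apply: le_trans (fF 0).
have -> : H * f (node k) = \int[mu]_x (f (node k) * kernel_cell k x).
  rewrite RintegralZl//; last exact: integrable_kernel_cell.
  by rewrite integral_kernel_cell_rV mulrC.
rewrite -RintegralB//; last 2 first.
- exact: integrable_f_kernel_cell.
- by apply: integrable_scale; exact: integrable_kernel_cell.
pose D x := f x * kernel_cell k x - f (node k) * kernel_cell k x.
have iD : mu.-integrable [set: 'rV[R]_n] (EFin \o D).
  apply: integrable_subR; first exact: integrable_f_kernel_cell.
  by apply: integrable_scale; exact: integrable_kernel_cell.
(* The cell kernel with its [i]-th factor replaced by the constant [th]. The sum over [i] dominates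
   the kernel at all far points without singling out the far coordinate. *)
pose Gj (i j : 'I_n) (t : R) : R := (if j == i then th else trig_kernel m (t / h j)) *
  (in_cell (h j) (k j) t)%:R.
pose vj (i j : 'I_n) : R := (if j == i then th else 1) * h j.
have mG i j : measurable_fun [set: R] (Gj i j).
  rewrite /Gj; case: eqP => _; last exact: mKc.
  by apply: measurable_funM => //; exact: measurable_in_cell.
have G0 i j t : 0 <= Gj i j t.
  by rewrite /Gj mulr_ge0//; case: ifP => // _; exact: trig_kernel_ge0.
have Gv i j : (\int[lebesgue_measure]_t (Gj i j t)%:E = (vj i j)%:E)%E.
  rewrite /Gj /vj; case: eqP => _; first exact: integral_cell.
  by rewrite mul1r; exact: integral_kernel_cell.
pose P i (x : 'rV[R]_n) := \prod_(j < n) Gj i j (x ord0 j).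
have iP i : mu.-integrable [set: 'rV[R]_n] (EFin \o P i).
  exact: integrable_rV_prod (mG i) (G0 i) (Gv i).
have P0 i x : 0 <= P i x by apply: prodr_ge0.
have IP i : \int[mu]_x P i x = th * H.
  rewrite (Rintegral_rV_prod (mG i) (G0 i) (Gv i)) big_split/=; congr (_ * _).
  by rewrite (bigD1 i)//= eqxx big1 ?mulr1// => j /negPf ->.
pose Bd x := e * kernel_cell k x + \sum_(i < n) (2 * F0) * P i x.
have iS : mu.-integrable [set: 'rV[R]_n]
    (EFin \o (fun x => \sum_(i < n) (2 * F0) * P i x)).
  by apply: integrable_bigsum => i; exact: integrable_scale.
have iK : mu.-integrable [set: 'rV[R]_n] (EFin \o (fun x => e * kernel_cell k x)).
  by apply: integrable_scale; exact: integrable_kernel_cell.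
have iB : mu.-integrable [set: 'rV[R]_n] (EFin \o Bd).
  exact: integrable_addR.
apply: (@le_trans _ _ (\int[mu]_x Bd x)); last first.
  rewrite /Bd RintegralD// RintegralZl//; last exact: integrable_kernel_cell.
  rewrite integral_kernel_cell_rV Rintegral_bigsum; last first.
    by move=> i; exact: integrable_scale.
  have -> : \sum_(i < n) \int[mu]_x (2 * F0 * P i x) =
      \sum_(i < n) 2 * F0 * (th * H).
    by apply: eq_bigr => i _; rewrite RintegralZl// IP.
  rewrite sumr_const card_ord -mulr_natl -/H le_eqVlt; apply/orP; left; apply/eqP.
  by ring.
apply: le_trans (le_normr_Rintegral _ iD) _ => //.
apply: le_Rintegral => //.
  by rewrite (_ : EFin \o _ = (fun x => `|(EFin \o D) x|)%E)//; exact: integrable_abse.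
move=> x _; rewrite /D -mulrBl normrM [X in _ * X]ger0_norm ?kernel_cell_ge0//.
have sum0 : 0 <= \sum_(i < n) (2 * F0) * P i x.
  by apply: sumr_ge0 => i _; rewrite mulr_ge0// mulr_ge0.
have [near_|] := pselect (forall j, `|x ord0 j / h j - (k j)%:~R| < d).
  by rewrite /Bd -[leLHS]addr0 lerD// ler_wpM2r ?kernel_cell_ge0// fe.
move=> /existsNP[i /negP]; rewrite -leNgt => di.
rewrite /Bd -[leLHS]add0r lerD ?mulr_ge0 ?kernel_cell_ge0//.
rewrite (bigD1 i)//= -[leLHS]addr0 lerD//; last first.
  by apply: sumr_ge0 => j _; rewrite mulr_ge0// mulr_ge0.
apply: ler_pM; rewrite ?kernel_cell_ge0//.
  by rewrite (le_trans (ler_normB _ _))// mulrDl !mul1r lerD.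
apply: ler_prod => j _; rewrite Kc_ge0/= /Gj.
case: eqP => [ji|//]; have [xc|] := boolP (in_cell _ _ _); last by rewrite !mulr0.
rewrite -ji in di; rewrite !mulr1 /th.
by apply: (@trig_kernel_decay _ m d (k j)) => //; rewrite di (in_cell_dist xc).
Qed.

End cell_integral.

(** An integer k satisfies |k| <= n/2 exactly when |k| <= floor(n/2), whatever the parity of n; this
    turns the rational bounds into conditions on a finite type. *)
Lemma trapezoidal_sum (V : zmodType) s (n : 'I_s -> nat) (P : nat)
    (F : 'rV[int]_s -> V) : (forall j, ((n j)./2 <= P)%N) ->
  \sum_(k \in trapezoidal_index n) F k =
  \sum_(g : {ffun 'I_s -> 'I_P.*2.+1} | g \in family
      (fun j (i : 'I_P.*2.+1) => (absz (i%:Z - P%:Z) <= (n j)./2)%N))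
    F (\row_j ((g j)%:Z - P%:Z)).
Proof.
move=> nP; set Q := fun j => _.
rewrite (bigfs _ (index_enum_uniq _)); last by move=> g _; rewrite mem_index_enum.
apply: (reindex_fsbig (fun g : {ffun 'I_s -> 'I_P.*2.+1} => \row_j ((g j)%:Z - P%:Z) : 'rV[int]_s)).
have half_le (a : nat) (b : int) :
    (- (a%:R / 2) <= b%:Q <= a%:R / 2) = (absz b <= a./2)%N.
  transitivity (absz b * 2 <= a)%N; last first.
    by rewrite -[in LHS](odd_double_half a); lia.
  rewrite -(ler_nat rat) natrM -ler_pdivlMr// -ler_norml natr_absz.
  by rewrite intr_norm.
split.
- move=> g /= /familyP gQ j; rewrite mxE half_le; exact: gQ.
- move=> g1 g2 _ _ /rowP g12; apply/ffunP => j; apply/val_inj/eqP.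
  by have := g12 j; rewrite !mxE => /addIr [/eqP].
- move=> k kn; have kb j : (absz (k ord0 j) <= (n j)./2)%N by rewrite -half_le; exact: kn.
  exists [ffun j => inord (absz (k ord0 j + P%:Z))].
    apply/familyP => j; rewrite ffunE.
    rewrite unfold_in.
    have := kb j; have := nP j => h1 h2.
    by rewrite inordK; lia.
  apply/rowP => j; rewrite mxE ffunE (_ : 0 = ord0); last exact/val_inj.
  have := kb j; have := nP j => h1 h2.
  by rewrite inordK; lia.
Qed.

(** * The quadrature error *)

(** A point whose cell index exceeds N in absolute value is at least N + 1/2 cell widths from 0.
    This is the origin of the box boundary used in the tail hypotheses below. *)
Lemma le_norm_floor_half (R : realType) (y : R) (N : nat) :
  ~~ (absz (Num.floor (y + 2^-1)) <= N)%N -> N%:R + 2^-1 <= `|y|.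
Proof.
have := Num.Theory.floor_itv (y + 2^-1).
set z := Num.floor _; rewrite intrD => /andP[z1 z2] zN.
have [zpos|zneg] : (N.+1%:Z <= z) \/ (z + 1 <= - (N%:Z)) by lia.
  have : N.+1%:R <= z%:~R :> R by rewrite -[_%:R]/(_%:Z%:~R) ler_int.
  by rewrite -natr1 => zr; rewrite (le_trans _ (ler_norm _))//; lra.
have : (z + 1)%:~R <= - N%:R :> R.
  by rewrite -[N%:R]/(N%:Z%:~R) -rmorphN/= ler_int.
by rewrite intrD => zr; rewrite -normrN (le_trans _ (ler_norm _))//; lra.
Qed.

Section quadrature_error.
Context {R : realType} {n : nat}.
Variables (h : 'I_n -> R) (f : 'rV[R]_n -> R) (F0 : R).
Local Notation mu := (@lebesgue_rV R n).
Hypotheses (h0 : forall j, 0 < h j) (cf : continuous f)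
  (fi : mu.-integrable [set: 'rV[R]_n] (EFin \o f))
  (fF : forall x, `|f x| <= F0).

(** Continuity at the node fixes [d] first; then [m] makes the geometric term small. Each of the two
    errors gets half of [eta]. *)
Lemma cell_integral_near (k : 'I_n -> int) (eta : R) : 0 < eta ->
  \forall m \near \oo, `|\int[mu]_x (f x * kernel_cell h m k x) -
    (\prod_(j < n) h j) * f (node h k)| <= eta.
Proof.
move=> eta0; set H := \prod_(j < n) h j.
have H0 : 0 < H by exact: prodr_gt0.
have F00 : 0 <= F0 by apply: le_trans (fF 0).
pose e := eta / (2 * H); have e0 : 0 < e by rewrite divr_gt0// mulr_gt0.
have /cvg_ballP/(_ _ e0)/nbhs_ballP[r r0 fr] := cf (x := node h k).
(* A common bound for the mesh sizes, positive also when [n = 0]; dividing by it converts the radius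
   of continuity into multiples of the mesh. *)
pose S := 1 + \sum_(j < n) h j.
have hS j : h j <= S.
  rewrite /S (bigD1 j)//= addrCA lerDl addr_ge0// sumr_ge0// => i _.
  exact/ltW.
have S0 : 0 < S by rewrite ltr_pwDl// sumr_ge0// => i _; exact/ltW.
pose d := Num.min (2^-1) (r / S).
have d0 : 0 < d by rewrite lt_min invr_gt0 ltr0n divr_gt0.
have d2 : d <= 2^-1 by rewrite ge_min lexx.
have dr : d * S <= r by rewrite -ler_pdivlMr// ge_min lexx orbT.
have fe (x : 'rV[R]_n) : (forall j, `|x ord0 j / h j - (k j)%:~R| < d) ->
    `|f x - f (node h k)| <= e.
  move=> xd; rewrite distrC; apply: ltW; apply: fr => //; split => // i j.
  rewrite (ord1 i) mxE /ball/= distrC.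
  have -> : x ord0 j - (k j)%:~R * h j = (x ord0 j / h j - (k j)%:~R) * h j.
    by rewrite mulrBl divfK// gt_eqF.
  rewrite normrM (gtr0_norm (h0 j)).
  apply: (@lt_le_trans _ _ (d * h j)); first by rewrite ltr_pM2r.
  by apply: le_trans dr; rewrite ler_pM2l.
pose q := cos (pi * d) ^+ 2.
have q01 : 0 <= q < 1.
  rewrite /q sqr_ge0/= expr_lt1//.
    rewrite -(@cos0 R) ltr_cos ?in_itv/=.
    - by rewrite mulr_gt0// pi_gt0.
    - by rewrite lexx ltW// pi_gt0.
    - by have := pi_gt0 R => pi0; apply/andP; split; nra.
  have pi0 := pi_gt0 R.
  by apply: cos_ge0_pihalf; apply/andP; split; nra.
(* The summand 1 keeps [c] positive when [F0] or [n] is 0. *)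
pose c := 2 * F0 * n%:R + 1.
have c0 : 0 < c by rewrite /c ltr_pwDr// !mulr_ge0.
have /(linear_geometric_small q01) : 0 < eta / (2 * H * c) by rewrite divr_gt0 ?mulr_gt0.
apply: filterS => m qm.
apply: le_trans (cell_integral m h0 fi fF (ltW e0) (ltW d0) fe) _.
rewrite -/H -/q mulrDl.
have eH : e * H = eta / 2 by rewrite /e; field; rewrite gt_eqF.
have : c * (m.*2.+1%:R * q ^+ m) * H <= eta / 2.
  have := ler_wpM2l (ltW c0) qm => /(ler_wpM2r (ltW H0))/le_trans; apply.
  by rewrite le_eqVlt; apply/orP; left; apply/eqP; field; rewrite !gt_eqF.
have th0 : 0 <= m.*2.+1%:R * q ^+ m.
  by apply: mulr_ge0 => //; apply: exprn_ge0; case/andP : q01.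
rewrite eH /c => h1.
have : 2 * F0 * (n%:R * (m.*2.+1%:R * q ^+ m)) * H <=
   (2 * F0 * n%:R + 1) * (m.*2.+1%:R * q ^+ m) * H.
  by rewrite ler_wpM2r ?(ltW H0)// [in leRHS]mulrDl mul1r mulrA lerDl.
lra.
Qed.

(* Node indices are stored in ['I_P.*2.+1] shifted by [P], so that all
   coordinates share one finite type. *)
Lemma sum_in_cell (P : nat) (N : nat) (u t : R) : (N <= P)%N ->
  \sum_(i < P.*2.+1 | (absz (i%:Z - P%:Z) <= N)%N) (in_cell u (i%:Z - P%:Z) t)%:R =
  (absz (Num.floor (t / u + 2^-1)) <= N)%N%:R :> R.
Proof.
move=> NP; rewrite /in_cell; set z := Num.floor _.
have [zN|zN] := boolP (absz z <= N)%N; last first.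
  rewrite big1// => i iN; case: eqP => // zi.
  by rewrite zi iN in zN.
have zP : (absz (z + P%:Z)%R < P.*2.+1)%N by lia.
rewrite (bigD1 (Ordinal zP))/=; last by lia.
rewrite big1 ?addr0.
  by rewrite (_ : _ == _); last by apply/eqP; lia.
move=> i /andP[_ iz]; case: eqP => // zi; case/eqP: iz.
by apply/val_inj => /=; lia.
Qed.

(** In the application [rho] consists of the factors of 1/omega, and [kap] of the rates of an
    exponential majorant of f outside the box. Only the comparison of [S] with the rule requires [m]
    large; its error [eta] is arbitrary and disappears from the conclusion. *)
Lemma quadrature_error (N : 'I_n -> nat) (G A T : R) (rho : 'I_n -> R -> R)
    (kap : 'I_n -> R) :
  0 <= G -> (forall j t, 0 <= rho j t) -> (forall j, rho j 0 = 1) ->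
  (forall xi, `|fourier_cos f xi| <= G * \prod_(j < n) rho j (xi ord0 j)) ->
  (forall m, \prod_(j < n) \sum_(i < m.*2.+1) rho j ((i%:R - m%:R) / h j) <= 1 + A) ->
  0 <= T -> (forall j, 0 < kap j) ->
  (forall (x : 'rV[R]_n) j, ((N j)./2%:R + 2^-1) * h j <= `|x ord0 j| ->
    `|f x| <= T * \prod_(j < n) expR (- (kap j * `|x ord0 j|))) ->
  `|\int[mu]_x f x - trapezoidal h N f| <=
    G * A + T * \prod_(j < n) (2 * (h j + (kap j)^-1)).
Proof.
move=> G0 rho0 rho1 fG rhoA T0 kap0 fT.
apply/ler_addgt0Pl => eta eta0.
pose P := \max_(j < n) (N j)./2.
have NP j : ((N j)./2 <= P)%N by exact: leq_bigmax.
pose Q j (i : 'I_P.*2.+1) := (absz (i%:Z - P%:Z) <= (N j)./2)%N.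
pose idx (g : {ffun 'I_n -> 'I_P.*2.+1}) j : int := (g j)%:Z - P%:Z.
have tE : trapezoidal h N f =
    \sum_(g : {ffun 'I_n -> 'I_P.*2.+1} | g \in family Q)
      (\prod_(j < n) h j) * f (node h (idx g)).
  rewrite /trapezoidal (trapezoidal_sum _ NP) mulr_sumr; apply: eq_bigr => g _.
  by congr (_ * f _); apply/rowP => j; rewrite !mxE.
set C := #|{: {ffun 'I_n -> 'I_P.*2.+1}}|%:R : R.
have C0 : 0 <= C by rewrite ler0n.
have eC : 0 < eta / (C + 1) by rewrite divr_gt0// ltr_wpDl.
have /(@filter_ex _ _ _) [m mP] :
  \forall m \near \oo, forall g : {ffun 'I_n -> 'I_P.*2.+1},
    `|\int[mu]_x (f x * kernel_cell h m (idx g) x) -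
      (\prod_(j < n) h j) * f (node h (idx g))| <= eta / (C + 1).
  by apply: filter_forall => g; exact: cell_integral_near.
set I1 := \int[mu]_x (f x * rV_kernel h m x).
set S := \sum_(g : {ffun 'I_n -> 'I_P.*2.+1} | g \in family Q)
  \int[mu]_x (f x * kernel_cell h m (idx g) x).
(* [I1] is compared with the integral (aliasing), its part [S] on the cells
   with the quadrature rule, and [I1 - S] is the truncation error. *)
have D1 : `|I1 - \int[mu]_x f x| <= G * A.
  apply: le_trans (aliasing_le h m fi G0 rho0 rho1 fG) _.
  by rewrite ler_wpM2l// lerBlDl.
have D2 : `|S - trapezoidal h N f| <= eta.
  rewrite tE -sumrB; apply: le_trans (ler_norm_sum _ _ _) _.
  apply: (@le_trans _ _ (\sum_(g : {ffun 'I_n -> 'I_P.*2.+1}) eta / (C + 1))).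
    rewrite big_mkcond/=; apply: ler_sum => g _.
    by case: ifP => _; [exact: mP|exact: ltW].
  rewrite sumr_const -[_ *+ _]mulr_natl -/C mulrCA -[leRHS]mulr1 ler_pM2l//.
  by rewrite ler_pdivrMr ?ltr_wpDl// mul1r lerDl.
pose K (x : 'rV[R]_n) : R := \prod_(j < n)
  (trig_kernel m (x ord0 j / h j) * expR (- (kap j * `|x ord0 j|))).
(* Only an upper bound for this integral is available; finiteness makes it a real number, to which
   the product formula applies. *)
pose v j : R := fine (\int[lebesgue_measure]_t
  (trig_kernel m (t / h j) * expR (- (kap j * `|t|)))%:E)%E.
have vlt j : (\int[lebesgue_measure]_t
    (trig_kernel m (t / h j) * expR (- (kap j * `|t|)))%:E <=
    (2 * (h j + (kap j)^-1))%:E)%E by exact: integral_trig_kernel_exp.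
have v0 j : (0 <= \int[lebesgue_measure]_t
    (trig_kernel m (t / h j) * expR (- (kap j * `|t|)))%:E)%E.
  by apply: integral_ge0 => t _; rewrite lee_fin mulr_ge0 ?trig_kernel_ge0 ?expR_ge0.
have vE j : (\int[lebesgue_measure]_t
    (trig_kernel m (t / h j) * expR (- (kap j * `|t|)))%:E = (v j)%:E)%E.
  rewrite fineK// ge0_fin_numE//; exact: le_lt_trans (vlt j) (ltry _).
have vle j : v j <= 2 * (h j + (kap j)^-1) by rewrite -lee_fin -vE.
have mKe j : measurable_fun [set: R]
    (fun t : R => trig_kernel m (t / h j) * expR (- (kap j * `|t|))).
  by apply: continuous_measurable_fun; exact: continuous_trig_kernel_exp.
have Ke0 j (t : R) : 0 <= trig_kernel m (t / h j) * expR (- (kap j * `|t|)).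
  by rewrite mulr_ge0 ?trig_kernel_ge0 ?expR_ge0.
have iK : mu.-integrable [set: 'rV[R]_n] (EFin \o K).
  exact: integrable_rV_prod mKe Ke0 vE.
pose Sx (x : 'rV[R]_n) : R := \sum_(g : {ffun 'I_n -> 'I_P.*2.+1} | g \in family Q)
  f x * kernel_cell h m (idx g) x.
(* Summing the cell indicators over all nodes gives the indicator of the box, so [I1 - S] is the
   integral over its complement. *)
have SxE x : Sx x = f x * rV_kernel h m x *
    \prod_(j < n) (absz (Num.floor (x ord0 j / h j + 2^-1)) <= (N j)./2)%N%:R.
  rewrite -(eq_bigr _ (fun j _ => sum_in_cell (h j) (x ord0 j) (NP j))).
  rewrite bigA_distr_big_dep mulr_sumr; apply: eq_bigr => g _.
  by rewrite kernel_cellE mulrA.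
have ifk g : mu.-integrable [set: 'rV[R]_n] (EFin \o (fun x => f x * kernel_cell h m (idx g) x)).
  exact: integrable_f_kernel_cell.
have SxE2 : Sx = fun x => \sum_(g <- [seq g <- index_enum {: {ffun 'I_n -> 'I_P.*2.+1}} | g \in family Q])
   f x * kernel_cell h m (idx g) x.
  by apply/funext => x; rewrite big_filter.
have iSx : mu.-integrable [set: 'rV[R]_n] (EFin \o Sx).
  by rewrite SxE2; exact: integrable_bigsum.
have ISx : \int[mu]_x Sx x = S.
  by rewrite SxE2 Rintegral_bigsum// big_filter.
have iI1 := integrable_f_kernel h m fi.
have D3 : `|I1 - S| <= T * \prod_(j < n) (2 * (h j + (kap j)^-1)).
  rewrite -ISx -RintegralB//.
  have iD := integrable_subR iI1 iSx.
  apply: le_trans (le_normr_Rintegral _ iD) _ => //.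
  apply: (@le_trans _ _ (\int[mu]_x (T * K x))); last first.
    rewrite RintegralZl// ler_wpM2l// (Rintegral_rV_prod mKe Ke0 vE).
    by apply: ler_prod => j _; rewrite vle fine_ge0.
  apply: le_Rintegral => //.
  - exact: (integrable_abse iD).
  - exact: integrable_scale.
  move=> x _; rewrite SxE -{1}[f x * rV_kernel h m x]mulr1 -mulrBr.
  have K0 : 0 <= T * K x by rewrite mulr_ge0// prodr_ge0.
  have [allN|] := pselect (forall j, absz (Num.floor (x ord0 j / h j + 2^-1)) <= (N j)./2)%N.
    by rewrite [X in 1 - X]big1 ?subrr ?mulr0 ?normr0// => j _; rewrite allN.
  move=> /existsNP[j /negP jN].
  rewrite (bigD1 j)//= (negPf jN) mul0r subr0 mulr1 normrM.
  rewrite (ger0_norm (rV_kernel_ge0 _ _ _)) /K big_split/= mulrCA mulrC.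
  rewrite ler_wpM2l ?rV_kernel_ge0//; apply: (fT x j).
  rewrite -ler_pdivlMr// -[X in _ / X](gtr0_norm (h0 j)) -normf_div.
  exact: le_norm_floor_half.
have -> : \int[mu]_x f x - trapezoidal h N f =
  - (I1 - \int[mu]_x f x) + (I1 - S) + (S - trapezoidal h N f) by ring.
apply: le_trans (ler_normD _ _) _; rewrite addrC lerD//.
by apply: le_trans (ler_normD _ _) _; rewrite normrN lerD.
Qed.

End quadrature_error.

(** * Asymptotic estimates *)

Section asymptotics.
Context {R : realType}.

Lemma inf_range_attained s (g : 'I_s -> R) : (0 < s)%N ->
  exists2 i, inf (range g) = g i & forall j, inf (range g) <= g j.
Proof.
move=> s0; pose i := [arg min_(j < Ordinal s0) g j]%O.
have gi j : g i <= g j by rewrite /i; case: arg_minP => // k _; apply.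
have lb : lbound (range g) (g i) by move=> _ [j _ <-].
have E : inf (range g) = g i.
  apply/eqP; rewrite eq_le; apply/andP; split.
    by apply: ge_inf; [exists (g i)|exists i].
  by apply: lb_le_inf => //; exists (g i); exists i.
by exists i => // j; rewrite E.
Qed.

Lemma sum_symmetric (phi : nat -> R) m :
  \sum_(i < m.*2.+1) phi (absz (i%:Z - m%:Z)) = phi 0%N + 2 * \sum_(i < m) phi i.+1.
Proof.
rewrite -(big_mkord xpredT (fun i : nat => phi (absz (i%:Z - m%:Z)))).
rewrite (@big_cat_nat _ _ _ m)//=; last by rewrite -addnn; lia.
rewrite [X in _ + X]big_ltn; last by rewrite -addnn; lia.
rewrite subrr big_nat_rev/= add0n addrCA mulrDl mul1r; congr (_ + (_ + _)).
  rewrite big_mkord; apply: eq_bigr => i _; congr phi.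
  by have := ltn_ord i; lia.
rewrite -[m.+1]add0n big_addn (_ : _ - _ = m)%N; last by rewrite -addnn; lia.
by rewrite big_mkord; apply: eq_bigr => i _; congr phi; lia.
Qed.

Lemma sum_inv_sqr_le m : \sum_(i < m) (i.+2%:R ^+ 2)^-1 <= 1 :> R.
Proof.
have : \sum_(i < m) (i.+2%:R ^+ 2)^-1 <= 1 - m.+1%:R^-1 :> R.
  elim: m => [|m IH]; first by rewrite big_ord0 invr1 subrr.
  rewrite big_ord_recr/=; apply: (le_trans (lerD IH (lexx _))).
  set x : R := m.+1%:R; have x0 : 0 < x by rewrite ltr0n.
  have -> : m.+2%:R = x + 1 by rewrite natr1.
  have -> : 1 - x^-1 + ((x + 1) ^+ 2)^-1 = 1 - (x + 1)^-1 - (x * (x + 1) ^+ 2)^-1.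
    by field; rewrite !gt_eqF// addr_gt0.
  by rewrite lerBlDr lerDl invr_ge0 mulr_ge0 ?sqr_ge0// ltW.
move=> /le_trans; apply; by rewrite lerBlDr lerDl invr_ge0.
Qed.

Lemma expRN_le_fact (r : nat) (y : R) : 0 < y -> expR (- y) <= r`!%:R / y ^+ r.
Proof.
move=> y0; rewrite ler_pdivlMr ?exprn_gt0// expRN mulrC ler_pdivrMr ?expR_gt0//.
case: r => [|r]; first by rewrite fact0 expr0 mul1r (le_trans _ (expR_ge1Dx _))// lerDl ltW.
have h := expR_ge1Dxn r (ltW y0).
rewrite mulrC -ler_pdivrMr ?ltr0n ?fact_gt0//; apply: le_trans h.
by rewrite lerDr.
Qed.

Lemma sum_expR_powR_near (b : R) : 0 < b ->
  \forall w \near +oo, forall m,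
    \sum_(i < m) expR (- (w * i.+1%:R `^ b)) <= 9 / 8 * expR (- w).
Proof.
move=> b0; pose th : R := 1 - 2 `^ (- b).
have th0 : 0 < th.
  rewrite subr_gt0 powRN invf_lt1 ?powR_gt0//.
  by have := gt0_ltr_powR b0; move=> /(_ 1 2); rewrite !nnegrE powR1; apply => //; rewrite ltr1n.
pose r := (Num.bound (2 / b)).
have rb : 2 <= b * r%:R.
  by rewrite mulrC -ler_pdivrMr//; apply/ltW/archi_boundP; rewrite divr_ge0// ltW.
have r0 : (0 < r)%N.
  by rewrite lt0n; apply/eqP => r0; rewrite r0 mulr0 in rb; move: rb; rewrite leNgt ltr0n.
(* The 8 makes the terms with k >= 2 sum to at most exp(-w)/8; with the term k = 1 this is the
   factor 9/8. *)
pose w0 : R := 8 * r`!%:R / th.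
(* For [k >= 2], [k `^ b - 1 >= th * k `^ b], so the k-th term is at most
   [expR (- w) * r`! / (w * th) ^+ r * k ^- 2] since [2 <= b * r]. *)
near=> w; move=> m.
have ww0 : w0 <= w by near: w; apply: nbhs_pinfty_ge; rewrite num_real.
have wth : 8 * r`!%:R <= w * th by rewrite -ler_pdivrMr.
have f1 : 1 <= r`!%:R :> R by rewrite ler1n fact_gt0.
have wth1 : 1 <= w * th by lra.
have w0' : 0 < w by rewrite -(pmulr_lgt0 _ th0); lra.
case: m => [|m]; first by rewrite big_ord0 mulr_ge0 ?expR_ge0.
rewrite big_ord_recl /= powR1 mulr1.
suff : \sum_(i < m) expR (- (w * (bump 0 i).+1%:R `^ b)) <=
    \sum_(i < m) (expR (- w) / 8) * (i.+2%:R ^+ 2)^-1.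
  rewrite -mulr_sumr => h; have := sum_inv_sqr_le m; have := expR_ge0 (- w).
  nra.
apply: ler_sum => i _; rewrite /bump add1n.
set k : R := i.+2%:R; have k0 : 0 < k by rewrite ltr0n.
have k2 : 2 <= k by rewrite ler_nat.
have kb : th * k `^ b <= k `^ b - 1.
  rewrite /th mulrBl mul1r lerD2l lerN2 powRN mulrC ler_pdivlMr ?powR_gt0// mul1r.
  by rewrite ge0_ler_powR ?nnegrE// ?(ltW b0) ?(ltW k0).
have kbr : k ^+ 2 <= (k `^ b) ^+ r.
  rewrite -!powR_mulrn ?powR_ge0 ?(ltW k0)// -powRrM.
  by apply: ler_powR => //; lra.
have -> : - (w * k `^ b) = - w + - (w * (k `^ b - 1)) by ring.
rewrite expRD -mulrA ler_wpM2l ?expR_ge0//.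
have kb0 : 0 < k `^ b by rewrite powR_gt0.
apply: (@le_trans _ _ (expR (- (w * (th * k `^ b))))).
  by rewrite ler_expR lerN2 ler_pM2l.
apply: le_trans (expRN_le_fact r _) _; first by rewrite !mulr_gt0.
rewrite mulrA exprMn ler_pdivrMr ?mulr_gt0 ?exprn_gt0 ?mulr_gt0//.
have wr : w * th <= (w * th) ^+ r by rewrite ler_eXnr.
have k20 : 0 < k ^+ 2 by rewrite exprn_gt0.
have : 1 <= (k ^+ 2)^-1 * (k `^ b) ^+ r by rewrite mulrC ler_pdivlMr// mul1r.
set K := _^-1 * _ => K1.
rewrite mulrCA [X in _ <= X](_ : _ = (w * th) ^+ r * (K / 8)); last by rewrite /K; ring.
nra.
Unshelve. all: by end_near. Qed.

(** Each factor is at most 1 + [tau] with [tau] = 9/4 exp(-w), and the product is at most exp(x)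
    with x = s [tau]. From exp(x)(1 - x) <= 1 and x <= 1/10 follows exp(x) <= 1 + 10/9 x, and 9/4 *
    10/9 = 5/2. *)
Lemma prod_theta_near s (b : 'I_s -> R) : (forall j, 0 < b j) ->
  \forall w \near +oo, forall m,
    \prod_(j < s) \sum_(i < m.*2.+1) expR (- (w * `|i%:R - m%:R| `^ b j))
    <= 1 + 5 / 2 * s%:R * expR (- w).
Proof.
move=> b0; near=> w; move=> m.
have wb : forall j m, \sum_(i < m) expR (- (w * i.+1%:R `^ b j)) <= 9 / 8 * expR (- w).
  by near: w; apply: filter_forall => j; exact: sum_expR_powR_near.
(* Together with w exp(-w) <= 1 this gives x <= (9/4)/23 < 1/10 below. *)
have ws : 23 * s%:R + 1 <= w by near: w; apply: nbhs_pinfty_ge; rewrite num_real.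
have s0 : 0 <= s%:R :> R by [].
have w0 : 0 < w by lra.
set tau := 9 / 4 * expR (- w).
have tau0 : 0 <= tau by rewrite mulr_ge0// expR_ge0.
apply: (@le_trans _ _ (\prod_(j < s) (1 + tau))).
  apply: ler_prod => j _; rewrite sumr_ge0/=; last by move=> i _; exact: expR_ge0.
  rewrite (eq_bigr (fun i : 'I_m.*2.+1 =>
      (fun k : nat => expR (- (w * k%:R `^ b j))) (absz (i%:Z - m%:Z)))); last first.
    by move=> i _; rewrite natr_absz intr_norm rmorphB.
  rewrite (sum_symmetric (fun k : nat => expR (- (w * k%:R `^ b j)))).
  rewrite powR0 ?gt_eqF// mulr0 oppr0 expR0 lerD2l /tau.
  by have := wb j m; lra.
rewrite prodr_const card_ord.
have we : w * expR (- w) <= 1.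
  have := expR_ge1Dx w; rewrite expRN ler_pdivrMr ?expR_gt0// mul1r; lra.
have e0 := expR_ge0 (- w).
set x := s%:R * tau.
have x0 : 0 <= x by rewrite mulr_ge0.
have x1 : x <= 10^-1.
  rewrite /x /tau; nra.
have E1 : (1 + tau) ^+ s <= expR x.
  by rewrite /x expRM_natl; apply: lerXn2r; rewrite ?nnegrE ?addr_ge0 ?expR_ge0// expR_ge1Dx.
have E2 : expR x * (1 - x) <= 1.
  have := expR_ge1Dx (- x); rewrite expRN => h.
  by have ex := expR_gt0 x; rewrite mulrC -ler_pdivlMr// mul1r.
have E3 : expR x <= 10 / 9 by have := expR_ge0 x; nra.
apply: (le_trans E1); apply: (@le_trans _ _ (1 + x * (10 / 9))); first nra.
rewrite lerD2l /x /tau; lra.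
Unshelve. all: by end_near. Qed.

Lemma powR_le_expR_near (K p : R) : 0 <= K ->
  \forall y \near +oo, K * y `^ p <= expR y.
Proof.
move=> K0; near=> y; pose r := Num.bound `|p|.
have pr : p <= r%:R := le_trans (ler_norm p) (ltW (archi_boundP (normr_ge0 p))).
have y1 : 1 <= y by near: y; apply: nbhs_pinfty_ge; rewrite num_real.
have yK : K * r.+1`!%:R <= y by near: y; apply: nbhs_pinfty_ge; rewrite num_real.
have y0 : 0 < y by lra.
apply: (@le_trans _ _ (K * y ^+ r)).
  by rewrite ler_wpM2l// -powR_mulrn ?(ltW y0)//; apply: ler_powR.
have := expR_ge1Dxn r (ltW y0) => /(le_trans _); apply.
rewrite (@le_trans _ _ (y ^+ r.+1 / r.+1`!%:R))// ?lerDr//.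
rewrite ler_pdivlMr ?ltr0n ?fact_gt0// exprS mulrAC ler_wpM2r// exprn_ge0// ltW.
Unshelve. all: by end_near. Qed.

Lemma Gamma_sum_ge s (b : 'I_s -> R) : (forall j, 0 < b j) ->
  3 * s%:R <= 4 * expR 1 * (\sum_(u : {set 'I_s} | u != finset.set0)
      \prod_(j in u) (Gamma (b j)^-1 / b j)).
Proof.
move=> b0.
have G1 j : 3 / 4 * expR (- 1) <= Gamma (b j)^-1 / b j.
  have bi : 0 < (b j)^-1 by rewrite invr_gt0.
  by rewrite ler_pdivlMr//; have := Gamma_ge bi; rewrite invrK.
have G0 j : 0 <= Gamma (b j)^-1 / b j.
  by apply: le_trans (G1 j); rewrite mulr_ge0 ?expR_ge0.
have P0 (u : {set 'I_s}) : 0 <= \prod_(j in u) (Gamma (b j)^-1 / b j) by apply: prodr_ge0.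
have : \sum_(j < s) (Gamma (b j)^-1 / b j) <=
    \sum_(u : {set 'I_s} | u != finset.set0) \prod_(j in u) (Gamma (b j)^-1 / b j).
  rewrite (bigID (fun u : {set 'I_s} => u \in [set finset.set1 j | j : 'I_s]%SET))/=.
  rewrite -[leLHS]addr0 lerD ?sumr_ge0//.
  rewrite (eq_bigl (mem [set finset.set1 j | j : 'I_s]%SET)); last first.
    move=> u /=; rewrite andb_idl// => /imsetP[j _ ->].
    by apply/set0Pn; exists j; rewrite finset.set11.
  rewrite big_imset/=; last by move=> i j _ _ /finset.set1_inj.
  by apply: ler_sum => j _; rewrite big_set1.
move=> h; apply: (@le_trans _ _ (4 * expR 1 * \sum_(j < s) (3 / 4 * expR (- 1)))).
  rewrite sumr_const card_ord -[_ *+ _]mulr_natl.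
  rewrite [leRHS](_ : _ = 3 * s%:R * (expR 1 * expR (- 1))); last by field.
  by rewrite -expRD subrr expR0 !mulr1.
rewrite ler_wpM2l ?mulr_ge0 ?expR_ge0//; apply: le_trans h; exact: ler_sum.
Qed.

End asymptotics.

(** * The error in terms of the mesh *)

Section error_bound.
Context {R : realType} {s : nat}.
Variables (a b c d e : 'I_s -> R).
Hypotheses (s_gt0 : (0 < s)%N) (a0 : forall j, 0 < a j) (b0 : forall j, 0 < b j)
  (c0 : forall j, 0 < c j) (d1 : forall j, 1 <= d j) (e0 : forall j, 0 < e j).

Let nu : 'rV[R]_s -> R := fun x =>
  expR (\sum_(j < s) e j * expR (c j * `|x ord0 j| `^ d j)).
Let omega : 'rV[R]_s -> R := fun xi =>
  expR (\sum_(j < s) a j * `|xi ord0 j| `^ b j).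
Let kap j := e j * c j / 2.

(** Bound, uniform for meshes with h <= 1, on the tail integral. The first product compensates the
    -1 in the linear minorant e_j c_j (t - 1) of the exponent of [nu], half of which has slope
    [kap j]; the second bounds the kernel integrals, using h_j <= a_j^(1/b_j). *)
Definition tail_constant : R :=
  (\prod_(j < s) expR (kap j)) * \prod_(j < s) (2 * (a j `^ (b j)^-1 + (kap j)^-1)).

Let kap_gt0 j : 0 < kap j. Proof. by rewrite !mulr_gt0 ?invr_gt0. Qed.

Let continuous_nu : continuous nu.
Proof.
move=> x; apply: (@continuous_comp _ _ _
  (fun x : 'rV[R]_s => \sum_(j < s) e j * expR (c j * `|x ord0 j| `^ d j)) expR);
  last exact: continuous_expR.
apply: (continuous_sum_rV (g := fun j t => e j * expR (c j * `|t| `^ d j))) => j t.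
apply: cvgM; first exact: cvg_cst.
apply: (@continuous_comp _ _ _ (fun t => c j * `|t| `^ d j) expR);
  last exact: continuous_expR.
apply: cvgM; first exact: cvg_cst.
by apply: continuous_norm_powR; exact: lt_le_trans (d1 j).
Qed.

Let continuous_omega : continuous omega.
Proof.
move=> x; apply: (@continuous_comp _ _ _
  (fun x : 'rV[R]_s => \sum_(j < s) a j * `|x ord0 j| `^ b j) expR);
  last exact: continuous_expR.
apply: (continuous_sum_rV (g := fun j t => a j * `|t| `^ b j)) => j t.
by apply: cvgM; [exact: cvg_cst|exact: continuous_norm_powR].
Qed.

(* The other half of the exponent of [nu] provides the factor [expR (- (M / 2))]
   outside the box. *)
Let half_weight_le (x : 'rV[R]_s) :
  expR (- (\sum_(j < s) e j * expR (c j * `|x ord0 j| `^ d j)) / 2) <=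
  (\prod_(j < s) expR (kap j)) * \prod_(j < s) expR (- (kap j * `|x ord0 j|)).
Proof.
rewrite -big_split/= mulNr mulr_suml -sumrN expR_sum.
apply: ler_prod => j _; rewrite expR_ge0/= -expRD ler_expR.
set t := `|x ord0 j|; have t0 : 0 <= t by exact: normr_ge0.
have tp : t - 1 <= t `^ d j.
  have [t1|t1] := leP t 1; first by rewrite (@le_trans _ _ 0) ?powR_ge0// subr_le0.
  rewrite (@le_trans _ _ t) ?lerBlDr ?lerDl// le1r_powR//; exact: ltW.
have et : c j * t `^ d j <= expR (c j * t `^ d j).
  by apply: le_trans (expR_ge1Dx _); rewrite lerDr.
have ct : c j * (t - 1) <= expR (c j * t `^ d j) by apply: le_trans et; rewrite ler_pM2l.
have ect : e j * (c j * (t - 1)) <= e j * expR (c j * t `^ d j) by rewrite ler_pM2l.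
rewrite /kap; lra.
Qed.

(** The constant is 3 = 5/2 + 1/2. As [M] is at least 4w, the factor exp(-M/2) is at most exp(-2w);
    one exp(-w) absorbs [tail_constant], leaving a truncation error of at most exp(-w)/2. *)
Lemma error_bound (hh M : R) (n : 'I_s -> nat) (f : 'rV[R]_s -> R) :
  let hv j := (a j * hh) `^ (b j)^-1 in
  0 < hh -> hh <= 1 -> 4 * hh^-1 <= M ->
  (forall j (t : R), ((n j)./2%:R + 2^-1) * hv j <= `|t| ->
    M <= e j * expR (c j * `|t| `^ d j)) ->
  (forall m, \prod_(j < s) \sum_(i < m.*2.+1)
      expR (- (hh^-1 * `|i%:R - m%:R| `^ b j)) <=
    1 + 5 / 2 * s%:R * expR (- hh^-1)) ->
  2 * tail_constant <= expR hh^-1 ->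
  in_E nu omega f ->
  (`| (\int[lebesgue_rV s]_x f x) - trapezoidal hv n f |%:E <=
    (3 * s%:R * expR (- hh^-1))%:E * E_norm nu omega f)%E.
Proof.
move=> hv hh0 hh1 wM tailM alias Uw [cf fi].
set w := hh^-1 in wM alias Uw *.
rewrite /E_norm; set F := ('N[_]_+oo[_])%E; set G := ('N[_]_+oo[_])%E => FG.
have F0 : (0 <= F)%E by exact: Lnorm_ge0.
have G0 : (0 <= G)%E by exact: Lnorm_ge0.
have Ffin : F \is a fin_num.
  by rewrite ge0_fin_numE//; apply: le_lt_trans FG; rewrite leeDl.
have Gfin : G \is a fin_num.
  by rewrite ge0_fin_numE//; apply: le_lt_trans FG; rewrite leeDr.
have [F' FE] : exists r, F = r%:E by exists (fine F); rewrite fineK.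
have [G' GE] : exists r, G = r%:E by exists (fine G); rewrite fineK.
rewrite FE lee_fin in F0; rewrite GE lee_fin in G0.
rewrite [X in (_ * X)%E](_ : _ = (F' + G')%:E); last by rewrite FE GE.
rewrite -EFinM lee_fin.
have fF x : `|f x| * nu x <= F'.
  apply: Lnorm_oo_weight => //; first by move=> y; exact: expR_ge0.
  by rewrite -/F FE.
have fG xi : `|fourier_cos f xi| * omega xi <= G'.
  apply: fourier_cos_le => //; first by move=> y; exact: expR_ge0.
  by rewrite -/G GE.
have ediv (u v z : R) : u * expR z <= v -> u <= v * expR (- z).
  by rewrite expRN ler_pdivlMr ?expR_gt0.
have sum_ge0 (x : 'rV[R]_s) : 0 <= \sum_(j < s) e j * expR (c j * `|x ord0 j| `^ d j).
  by apply: sumr_ge0 => j _; rewrite mulr_ge0 ?expR_ge0// ltW.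
have fF1 x : `|f x| <= F'.
  apply: le_trans (ediv _ _ _ (fF x)) _.
  by rewrite -[leRHS]mulr1 ler_wpM2l// expR_le1 oppr_le0.
pose rho j (t : R) : R := expR (- (a j * `|t| `^ b j)).
have fr (xi : 'rV[R]_s) : `|fourier_cos f xi| <= G' * \prod_(j < s) rho j (xi ord0 j).
  by apply: le_trans (ediv _ _ _ (fG xi)) _; rewrite -sumrN expR_sum.
have hv0 j : 0 < hv j by rewrite powR_gt0// mulr_gt0.
(* This is what the mesh sizes (a_j h)^(1/b_j) achieve: a_j |k/h_j|^(b_j) = w |k|^(b_j), with the
   same w in every coordinate. *)
have rhoE m j (i : 'I_m.*2.+1) :
    rho j ((i%:R - m%:R) / hv j) = expR (- (w * `|i%:R - m%:R| `^ b j)).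
  rewrite /rho normrM normfV (gtr0_norm (hv0 j)) powRM ?invr_ge0 ?(ltW (hv0 j))//.
  rewrite -powR_inv1 ?(ltW (hv0 j))// -powRrM mulN1r powRN -powRrM.
  rewrite mulVf ?gt_eqF// powRr1 ?mulr_ge0 ?(ltW (a0 j)) ?(ltW hh0)//.
  by congr (expR (- _)); rewrite /w; field; rewrite !gt_eqF.
have fT (x : 'rV[R]_s) j : ((n j)./2%:R + 2^-1) * hv j <= `|x ord0 j| ->
    `|f x| <= (F' * expR (- (M / 2)) * \prod_(j < s) expR (kap j)) *
      \prod_(j < s) expR (- (kap j * `|x ord0 j|)).
  move=> /tailM Mx; apply: le_trans (ediv _ _ _ (fF x)) _.
  rewrite -!mulrA ler_wpM2l//.
  apply: le_trans (ler_wpM2l (expR_ge0 _) (half_weight_le x)).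
  rewrite -expRD ler_expR; set S := \sum_(j < s) _.
  have : M <= S.
    apply: le_trans Mx _; rewrite /S (bigD1 j)//= lerDl sumr_ge0// => i _.
    by rewrite mulr_ge0 ?expR_ge0// ltW.
  by lra.
apply: le_trans (quadrature_error hv0 cf fi fF1 (N := n) (G := G')
  (A := 5 / 2 * s%:R * expR (- w)) (T := F' * expR (- (M / 2)) * \prod_(j < s) expR (kap j))
  (rho := rho) (kap := kap) G0 _ _ fr _ _ kap_gt0 fT) _.
- by move=> j t; exact: expR_ge0.
- by move=> j; rewrite /rho normr0 powR0 ?gt_eqF// mulr0 oppr0 expR0.
- move=> m; apply: le_trans (alias m); rewrite le_eqVlt; apply/orP; left; apply/eqP.
  by apply: eq_bigr => j _; apply: eq_bigr => i _; exact: rhoE.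
- by rewrite !mulr_ge0 ?expR_ge0// prodr_ge0// => j _; exact: expR_ge0.
have K0 : 0 <= \prod_(j < s) expR (kap j) by apply: prodr_ge0 => j _; exact: expR_ge0.
have hU : (\prod_(j < s) expR (kap j)) * \prod_(j < s) (2 * (hv j + (kap j)^-1)) <= tail_constant.
  rewrite /tail_constant ler_wpM2l//; apply: ler_prod => j _.
  have ki : 0 < (kap j)^-1 by rewrite invr_gt0.
  rewrite mulr_ge0 ?addr_ge0 ?(ltW ki) ?(ltW (hv0 j))//= ler_pM2l// lerD2r.
  rewrite /hv ge0_ler_powR ?nnegrE ?invr_ge0 ?mulr_ge0 ?(ltW (a0 j)) ?(ltW (b0 j)) ?(ltW hh0)//.
  by rewrite -[leRHS]mulr1 ler_pM2l.
have eM : expR (- (M / 2)) <= expR (- w) * expR (- w).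
  by rewrite -expRD ler_expR; lra.
have ew : expR w * expR (- w) = 1 by rewrite -expRD subrr expR0.
have w0 := expR_gt0 (- w).
have s1 : 1 <= s%:R :> R by rewrite ler1n.
have tU : expR (- (M / 2)) * ((\prod_(j < s) expR (kap j)) * \prod_(j < s) (2 * (hv j + (kap j)^-1)))
    <= s%:R / 2 * expR (- w).
  apply: (@le_trans _ _ (expR (- w) * expR (- w) * (expR w / 2))).
    apply: ler_pM; rewrite ?expR_ge0 ?mulr_ge0//.
      apply: prodr_ge0 => j _; rewrite mulr_ge0 ?addr_ge0 ?invr_ge0 ?(ltW (hv0 j))//.
      exact/ltW/kap_gt0.
    by apply: le_trans hU _; rewrite ler_pdivlMr// mulrC.
  rewrite [leLHS](_ : _ = expR w * expR (- w) * (expR (- w) / 2)); last by ring.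
  by rewrite ew mul1r; nra.
have sw : 0 <= s%:R * expR (- w) by rewrite mulr_ge0 ?expR_ge0.
have FF := ler_wpM2l F0 tU.
have Gs := mulr_ge0 G0 sw; have Fs := mulr_ge0 F0 sw.
rewrite -!mulrA in FF *; lra.
Qed.

End error_bound.

(** * Size of the mesh, number of nodes and extent of the box *)

Section mesh_regime.
Context {R : realType} {s : nat}.
Variables (a b c d : 'I_s -> R).
Hypotheses (a0 : forall j, 0 < a j) (b0 : forall j, 0 < b j)
  (c0 : forall j, 0 < c j) (d0 : forall j, 0 < d j).

Let B : R := \sum_(j < s) (b j)^-1.
Let D : R := \sum_(j < s) (d j)^-1.
Let C j : R := c j `^ (d j)^-1 * a j `^ (b j)^-1 / 2.

Lemma prod_powR (I : Type) (r : seq I) (x : R) (p : I -> R) : 0 < x ->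
  \prod_(i <- r) x `^ p i = x `^ (\sum_(i <- r) p i).
Proof.
move=> x0; elim: r => [|i r IH]; first by rewrite !big_nil powRr0.
by rewrite !big_cons IH powRD// (gt_eqF x0) implybT.
Qed.

Variables (Cs N l : R).
Hypotheses (B_gt0 : 0 < B) (D_gt0 : 0 < D) (Cs0 : 0 < Cs) (CsC : forall j, Cs <= C j)
  (N_gt0 : 0 < N) (l_gt0 : 0 < l).

Let h : R := N `^ (- B^-1) * l `^ (D / B).
(** The real number whose floor defines [n_j + 1]. *)
Let X j : R := Cs * h `^ (B / (D * d j)) * N `^ (D * d j)^-1 / (C j * h `^ (b j)^-1).

Let C_gt0 j : 0 < C j.
Proof. exact: lt_le_trans (CsC j). Qed.

Let h_gt0 : 0 < h.
Proof. by rewrite mulr_gt0 ?powR_gt0. Qed.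

Lemma mesh_inv : h^-1 = N `^ B^-1 / l `^ (D / B).
Proof. by rewrite /h invfM powRN invrK. Qed.

Lemma mesh_powB : h `^ B = N^-1 * l `^ D.
Proof.
rewrite /h powRM ?powR_ge0// -!powRrM mulNr mulVf ?gt_eqF// divfK ?gt_eqF//.
by rewrite powR_inv1// ltW.
Qed.

Lemma node_countE j : X j = Cs / C j * l `^ (d j)^-1 / h `^ (b j)^-1.
Proof.
rewrite /X powRrM -[Cs * _ * _]mulrA -powRM ?powR_ge0 ?(ltW N_gt0)//.
have -> : h `^ B * N = l `^ D by rewrite mesh_powB mulrAC mulVf ?gt_eqF// mul1r.
rewrite -powRrM.
have -> : D * (D * d j)^-1 = (d j)^-1 by field; rewrite !gt_eqF.
by field; rewrite !gt_eqF ?powR_gt0.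
Qed.

Lemma node_count_gt0 j : 0 < X j.
Proof.
rewrite node_countE; apply: divr_gt0; last exact: powR_gt0.
by apply: mulr_gt0; [exact: divr_gt0|exact: powR_gt0].
Qed.

(** Each ratio [Cs / C j] is at most 1. In the remaining product the exponents add up to [D] and
    [B], and h^B = l^D / N makes it equal to [N]. *)
Lemma prod_node_count : \prod_(j < s) X j <= N.
Proof.
apply: (@le_trans _ _ (\prod_(j < s) (l `^ (d j)^-1 / h `^ (b j)^-1))).
  apply: ler_prod => j _; rewrite (ltW (node_count_gt0 j))/= node_countE.
  rewrite -[X in _ <= X]mul1r -mulrA ler_wpM2r ?divr_ge0 ?powR_ge0//.
  by rewrite ler_pdivrMr// mul1r.
rewrite prodf_div !prod_powR// -/B -/D mesh_powB le_eqVlt.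
by apply/orP; left; apply/eqP; field; rewrite !gt_eqF ?powR_gt0.
Qed.

(** Full width of the box before rounding. The form of [C j] cancels [a j], and [c j] enters so that
    c_j (width/4)^(d_j) = (Cs/2)^(d_j) l, the quantity behind [Csharp]. *)
Lemma node_count_mesh j : X j * (a j * h) `^ (b j)^-1 = 2 * Cs * l `^ (d j)^-1 / c j `^ (d j)^-1.
Proof.
rewrite node_countE powRM ?(ltW (a0 j)) ?(ltW h_gt0)// /C.
by field; rewrite !gt_eqF ?powR_gt0.
Qed.

Lemma node_count_ge4 j : 1 <= l -> (4 * C j / Cs) `^ b j <= h^-1 -> 4 <= X j.
Proof.
move=> l1 wj; rewrite node_countE.
have l1' : 1 <= l `^ (d j)^-1.
  have := ge0_ler_powR (_ : 0 <= (d j)^-1) _ _ l1; rewrite powR1; apply.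
  - by rewrite invr_ge0 ltW.
  - by rewrite nnegrE.
  - by rewrite nnegrE ltW.
have x0 : 0 < 4 * C j / Cs by rewrite divr_gt0// mulr_gt0.
have hw : 4 * C j / Cs <= (h `^ (b j)^-1)^-1.
  have -> : (h `^ (b j)^-1)^-1 = h^-1 `^ (b j)^-1.
    by rewrite -powRN -(powR_inv1 (ltW h_gt0)) -powRrM mulN1r.
  have E : 4 * C j / Cs = ((4 * C j / Cs) `^ b j) `^ (b j)^-1.
    by rewrite -powRrM mulfV ?gt_eqF// powRr1// ltW.
  rewrite E; apply: ge0_ler_powR => //; rewrite ?nnegrE ?powR_ge0 ?invr_ge0//.
  - exact: ltW.
  - exact: ltW.
have -> : 4 = Cs / C j * 1 * (4 * C j / Cs) :> R by field; rewrite !gt_eqF.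
apply: ler_pM => //; first by rewrite mulr1 divr_ge0// ltW.
  exact: ltW.
by rewrite ler_pM2l// divr_gt0.
Qed.

(** Rounding costs at most half of the box: X < n + 2 and n <= 2 floor(n/2) + 1 give floor(n/2) +
    1/2 > X/2 - 1, which is at least X/4 exactly when X >= 4. *)
Lemma tail_exponent_ge j (n : nat) (t : R) : 4 <= X j -> X j < n.+2%:R ->
  (n./2%:R + 2^-1) * (a j * h) `^ (b j)^-1 <= `|t| ->
  (Cs / 2) `^ d j * l <= c j * `|t| `^ d j.
Proof.
move=> X4 Xn; set g := _ `^ _ => ht.
have g0 : 0 < g by rewrite powR_gt0// mulr_gt0.
have n2 : n%:R <= 2 * n./2%:R + 1 :> R.
  rewrite -natrM natr1 ler_nat mul2n -[n in (n <= _)%N]odd_double_half.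
  by case: (odd n); rewrite ?add1n ?add0n.
have Xn' : X j < n%:R + 2 by rewrite -natrD addn2.
have h1 : X j / 4 * g <= `|t|.
  by apply: le_trans ht; rewrite ler_pM2r//; lra.
have E : X j / 4 * g = Cs / 2 * l `^ (d j)^-1 / c j `^ (d j)^-1.
  by rewrite mulrAC /g node_count_mesh; field; rewrite gt_eqF// powR_gt0.
rewrite E in h1.
have lc0 : 0 <= Cs / 2 * l `^ (d j)^-1 / c j `^ (d j)^-1.
  by rewrite divr_ge0 ?mulr_ge0 ?powR_ge0 ?invr_ge0 ?(ltW Cs0).
have := ge0_ler_powR (ltW (d0 j)) _ _ h1; rewrite !nnegrE lc0 normr_ge0.
move=> /(_ isT isT); rewrite -(ler_pM2l (c0 j)); apply: le_trans.
have Cs2 : 0 <= Cs / 2 by rewrite divr_ge0// ltW.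
have Csl : 0 <= Cs / 2 * l `^ (d j)^-1 by rewrite mulr_ge0// powR_ge0.
have ci : 0 <= (c j `^ (d j)^-1)^-1 by rewrite invr_ge0 powR_ge0.
rewrite (powRM _ Csl ci) (powRM _ Cs2 (powR_ge0 _ _)).
have -> : (l `^ (d j)^-1) `^ d j = l by rewrite -powRrM mulVf ?gt_eqF// powRr1// ltW.
have -> : (c j `^ (d j)^-1)^-1 `^ d j = (c j)^-1.
  by rewrite -powRN -powRrM mulNr mulVf ?gt_eqF// powR_inv1// ltW.
by rewrite mulrCA mulfV ?gt_eqF// mulr1.
Qed.

End mesh_regime.

(** * Choice of the threshold in N and assembly of the estimates *)

Lemma log_threshold (R : realType) (y0 x : R) : 0 < x ->
  exists N0 : nat, forall N : nat, (N0 <= N)%N -> 0 < N%:R :> R /\ y0 < ln (x * N%:R).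
Proof.
move=> x0; pose K := expR y0 / x; have K0 : 0 < K by rewrite divr_gt0// expR_gt0.
exists (Num.bound K) => N N0N.
have KN : K < N%:R.
  by apply: lt_le_trans (archi_boundP (ltW K0)) _; rewrite ler_nat.
have N0 : 0 < N%:R :> R by exact: lt_trans KN.
split => //; rewrite -ltr_expR lnK ?posrE ?mulr_gt0//.
by move: KN; rewrite /K ltr_pdivrMr// mulrC.
Qed.

Theorem theorem5 (R : realType) (s : nat) (hs : (0 < s)%N)
    (a b c d e : 'I_s -> R)
    (ha : forall j, 0 < a j) (hb : forall j, 0 < b j)
    (hc : forall j, 0 < c j) (hd : forall j, 1 <= d j)
    (he : forall j, 0 < e j) :
  let nu : 'rV[R]_s -> R := fun x =>
    expR (\sum_(j < s) e j * expR (c j * `|x ord0 j| `^ d j)) in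
  let omega : 'rV[R]_s -> R := fun xi =>
    expR (\sum_(j < s) a j * `|xi ord0 j| `^ b j) in
  let B : R := \sum_(j < s) (b j)^-1 in
  let D : R := \sum_(j < s) (d j)^-1 in
  let C : 'I_s -> R := fun j =>
    c j `^ (d j)^-1 * a j `^ (b j)^-1 / 2 in
  let Cstar : R := inf (range C) in
  let Csharp : R := inf (range (fun j => (Cstar / 2) `^ d j)) in
  let estar : R := inf (range e) in
  let C' : R :=
    4 * s%:R * (\prod_(j < s) (expR (- e j) *
      (a j `^ (b j)^-1 +
       2 * (Gamma (d j)^-1 / (e j * c j `^ (d j)^-1 * d j))))) +
    4 * expR 1 * (\sum_(u : {set 'I_s} | u != finset.set0)
      \prod_(j in u) (Gamma (b j)^-1 / b j)) in
  exists N0 : nat, forall N : nat, (N0 <= N)%N ->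
  let L : R := ln (estar `^ (- B) * N%:R) in
  let h : R := N%:R `^ (- B^-1) * (L / (Csharp * B)) `^ (D / B) in
  let hvec : 'I_s -> R := fun j => (a j * h) `^ (b j)^-1 in
  forall n : 'I_s -> nat,
  (forall j, (n j).+1%:Z =
     Num.max (Num.floor (Cstar * h `^ (B / (D * d j)) *
                           N%:R `^ (D * d j)^-1 /
                         (C j * h `^ (b j)^-1))) 1) ->
  (forall f : 'rV[R]_s -> R, in_E nu omega f ->
     (`| (\int[lebesgue_rV s]_x f x) - trapezoidal hvec n f |%:E <=
      (C' * expR (- (N%:R `^ B^-1 * L `^ (- (D / B)) *
                     Csharp `^ (D / B) * B `^ (D / B))))%:E *
      E_norm nu omega f)%E) /\
  (\prod_(j < s) (n j).+1 <= N)%N.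
Proof.
move=> nu omega B D C Cstar Csharp estar C'.
have d0 j : 0 < d j by exact: lt_le_trans (hd j).
have sum_gt0 (p : 'I_s -> R) : (forall j, 0 < p j) -> 0 < \sum_(j < s) (p j)^-1.
  move=> p0; rewrite (bigD1 (Ordinal hs))//= ltr_pwDl ?invr_gt0// sumr_ge0// => i _.
  by rewrite invr_ge0 ltW.
have B0 : 0 < B by exact: sum_gt0.
have D0 : 0 < D by exact: sum_gt0.
have C0 j : 0 < C j by rewrite !mulr_gt0 ?powR_gt0.
have [i1 Ci1 CstarC] := inf_range_attained C hs.
have Cstar0 : 0 < Cstar by rewrite /Cstar Ci1.
have [i2 Ci2 CsharpC] := inf_range_attained (fun j => (Cstar / 2) `^ d j) hs.
have Csharp0 : 0 < Csharp by rewrite /Csharp Ci2 powR_gt0// divr_gt0.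
have [i3 Ci3 estarC] := inf_range_attained e hs.
have estar0 : 0 < estar by rewrite /estar Ci3.
have C'3 : 3 * s%:R <= C'.
  apply: le_trans (Gamma_sum_ge hb) _; rewrite lerDr !mulr_ge0// prodr_ge0// => j _.
  by rewrite mulr_ge0 ?expR_ge0// addr_ge0 ?powR_ge0// mulr_ge0// divr_ge0 ?Gamma_ge0//
    !mulr_ge0 ?powR_ge0// ltW.
(* Everything asked of w = 1/h, independently of f and N. The last condition yields X_j >= 4. *)
have [w0 [_ Hw]] : \forall w \near +oo, [/\ 1 <= w,
    (forall m, \prod_(j < s) \sum_(i < m.*2.+1) expR (- (w * `|i%:R - m%:R| `^ b j))
      <= 1 + 5 / 2 * s%:R * expR (- w)),
    2 * tail_constant a b c e <= expR w &
    forall j, (4 * C j / Cstar) `^ b j <= w].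
  near=> w; split.
  - by near: w; apply: nbhs_pinfty_ge; rewrite num_real.
  - by near: w; exact: prod_theta_near.
  - apply: (@le_trans _ _ w).
      by near: w; apply: nbhs_pinfty_ge; rewrite num_real.
    by apply: le_trans (expR_ge1Dx _); rewrite lerDr.
  - by near: w; apply: filter_forall => j; apply: nbhs_pinfty_ge; rewrite num_real.
pose q := D / B; have q0 : 0 < q by exact: divr_gt0.
(* A positive number strictly above [w0], which may be negative. *)
pose W := `|w0| + 1; have W0 : 0 < W by rewrite ltr_wpDl.
(* Conditions on y = L / B, with l = y / [Csharp]: the second says l >= 1, the third gives 4/h <=
   N^(1/B), and the last gives 1/h >= [W]. The last holds for large y because an exponential beats a
   power. *)
have [y0 [_ Hy]] : \forall y \near +oo, [/\ 0 < y, 1 <= y / Csharp,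
    4 <= (y / Csharp) `^ q & W * (y / Csharp) `^ q <= estar * expR y].
  near=> y.
  have y_gt0 : 0 < y by near: y; apply: nbhs_pinfty_gt; rewrite num_real.
  have yC1 : Csharp <= y by near: y; apply: nbhs_pinfty_ge; rewrite num_real.
  have yC4 : 4 `^ q^-1 * Csharp <= y.
    by near: y; apply: nbhs_pinfty_ge; rewrite num_real.
  have yK : W * Csharp `^ (- q) / estar * y `^ q <= expR y.
    near: y; apply: powR_le_expR_near.
    by apply: divr_ge0; [apply: mulr_ge0; [exact: ltW|exact: powR_ge0]|exact: ltW].
  have yC0 : 0 <= y / Csharp by apply: divr_ge0; exact: ltW.
  split.
  - exact: y_gt0.
  - by rewrite ler_pdivlMr// mul1r.
  - have E4 : (4 `^ q^-1) `^ q = 4 :> R by rewrite -powRrM mulVf ?gt_eqF// powRr1.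
    rewrite -[X in X <= _]E4; apply: ge0_ler_powR.
    + exact: ltW.
    + by rewrite nnegrE powR_ge0.
    + by rewrite nnegrE.
    + by rewrite ler_pdivlMr.
  - apply: (@le_trans _ _ (estar * (W * Csharp `^ (- q) / estar * y `^ q))); last first.
      by rewrite ler_pM2l.
    have -> : y `^ q = (y / Csharp) `^ q * Csharp `^ q.
      by rewrite -powRM ?(ltW Csharp0)// divfK// gt_eqF.
    rewrite powRN le_eqVlt; apply/orP; left; apply/eqP.
    by field; rewrite !gt_eqF// powR_gt0.
have [N0 HN] := log_threshold (B * y0) (powR_gt0 (- B) estar0).
exists N0 => N /HN[N_gt0 LN] L h hvec n hn.
(* With [l] the ratio [L / (Csharp * B)], [h^-1] is [N%:R `^ B^-1 / l `^ q], and
   [estar * expR y] is [N%:R `^ B^-1]. *)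
pose y := L / B.
have yy : y0 < y by rewrite ltr_pdivlMr// mulrC.
have [y_gt0 l1 l4 lW] := Hy y yy.
set l := y / Csharp in l1 l4 lW.
have l0 : 0 < l by lra.
have lE : L / (Csharp * B) = l by rewrite /l /y; field; rewrite !gt_eqF.
have hE : h = N%:R `^ (- B^-1) * l `^ q by rewrite /h lE.
have h0 : 0 < h by rewrite hE mulr_gt0 ?powR_gt0.
have wE : h^-1 = N%:R `^ B^-1 / l `^ q.
  by rewrite hE; exact: mesh_inv.
have NE : estar * expR y = N%:R `^ B^-1.
  rewrite /y expRM lnK ?posrE ?mulr_gt0 ?powR_gt0//.
  rewrite (powRM _ (powR_ge0 _ _) (ltW N_gt0)) mulrA -[X in _ * X * _]powRrM.
  have -> : - B * B^-1 = -1 by rewrite mulNr mulfV// gt_eqF.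
  by rewrite (powR_inv1 (ltW estar0)) mulfV ?gt_eqF// mul1r.
have lq0 : 0 < l `^ q by exact: powR_gt0.
have ww : w0 < h^-1.
  apply: lt_le_trans (_ : W <= _).
    by rewrite /W (le_lt_trans (ler_norm _))// ltrDl.
  by rewrite wE ler_pdivlMr// -NE.
have [w1 walias wU wX] := Hw _ ww.
have wM : 4 * h^-1 <= N%:R `^ B^-1.
  by rewrite wE mulrA ler_pdivrMr// mulrC ler_wpM2l// powR_ge0.
(* The exponent in the claimed bound is exactly 1/h, as L = l [Csharp] B. *)
have expE : N%:R `^ B^-1 * L `^ (- (D / B)) * Csharp `^ (D / B) * B `^ (D / B) = h^-1.
  have -> : L = l * (Csharp * B) by rewrite -lE divfK// gt_eqF// mulr_gt0.
  rewrite wE powRN -/q (powRM _ (ltW l0) (mulr_ge0 (ltW Csharp0) (ltW B0))).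
  rewrite (powRM _ (ltW Csharp0) (ltW B0)).
  by field; rewrite !gt_eqF ?powR_gt0.
pose X j := Cstar * h `^ (B / (D * d j)) * N%:R `^ (D * d j)^-1 / (C j * h `^ (b j)^-1).
have X4 j : 4 <= X j.
  have := @node_count_ge4 _ _ a b c d hb d0 Cstar N%:R l B0 D0 Cstar0 CstarC N_gt0 l0 j l1.
  by rewrite -/B -/D -/q -hE; apply; exact: wX.
have Xn j : (n j).+1%:R <= X j < (n j).+2%:R.
  (* The floor is at least 1 since X_j >= 4, so the maximum with 1 is inactive. *)
  have nX : (n j).+1%:Z = Num.floor (X j).
    rewrite hn max_l// -/(X j) floor_ge_int.
    by rewrite (le_trans _ (X4 j))// ler1n.
  have := Num.Theory.floor_itv (X j); rewrite -nX.
  by rewrite intrD -[(n j).+2%:R]natr1.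
split; last first.
  rewrite -(ler_nat R) natr_prod.
  apply: (@le_trans _ _ (\prod_(j < s) X j)).
    by apply: ler_prod => j _; case/andP: (Xn j) => ->; rewrite ler0n.
  have := @prod_node_count _ _ a b c d d0 Cstar N%:R l B0 D0 Cstar0 CstarC N_gt0 l0.
  by rewrite -/B -/D -/q -hE.
move=> f fE; rewrite expE.
have tailM j (t : R) : ((n j)./2%:R + 2^-1) * hvec j <= `|t| ->
    N%:R `^ B^-1 <= e j * expR (c j * `|t| `^ d j).
  move=> ht.
  have := @tail_exponent_ge _ _ a b c d ha hc d0 Cstar N%:R l B0 D0 Cstar0 CstarC N_gt0 l0
    j (n j) t; rewrite -/B -/D -/q -hE => /(_ (X4 j)).
  case/andP: (Xn j) => _ Xn2 /(_ Xn2 ht) H.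
  (* Here the normalisation by [estar] inside the logarithm enters: N^(1/B) = [estar] exp(y) and y =
     [Csharp] l, so [estar <= e j] and the lower bound on the tail exponent suffice, factor by
     factor. *)
  rewrite -NE; apply: ler_pM; [exact: ltW|exact: expR_ge0|exact: estarC|].
  rewrite ler_expR; apply: le_trans H.
  have -> : y = Csharp * l by rewrite /l mulrC divfK// gt_eqF.
  by rewrite ler_wpM2r ?(ltW l0)//; exact: CsharpC.
have h1 : h <= 1 by rewrite -[h]invrK invf_le1// invr_gt0.
have Q := error_bound hs ha hb hc hd he h0 h1 wM tailM walias wU fE.
apply: (le_trans Q); rewrite lee_wpmul2r//.
  by rewrite /E_norm adde_ge0// Lnorm_ge0.
by rewrite lee_fin ler_wpM2r ?expR_ge0.
Unshelve. all: by end_near. Qed.
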